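(* Let $H$ be a Hopf algebra over a field $\Bbbk$, $A$ a right $H$-comodule algebra such that $B:=A^{\mathrm{co}H}\subseteq A$ is a Hopf--Galois extension, and $\mathfrak{g}$ a bicovariant quantum tangent space on $H$. Let $(\Gamma,\mathrm{d}_H)$ be the bicovariant first order differential calculus on $H$ dual to the bicovariant first order vector field calculus $H\otimes\mathfrak{g}$, and let $\Lambda\subseteq\Gamma$ be its subspace of left $H$-coinvariant elements, so that $\Lambda$ and $\mathfrak{g}$ are dual vector spaces. Then the vertical vector fields $\mathfrak{X}_{\mathrm{ver}}:=A\otimes\mathfrak{g}$ are dual to the vertical forms $\Gamma_{\mathrm{ver}}:=A\otimes\Lambda$; that is, $\mathfrak{X}_{\mathrm{ver}}\cong\mathrm{Hom}_A(\Gamma_{\mathrm{ver}},A)$ as right $H$-covariant first order vector field calculi on $A$ and $\Gamma_{\mathrm{ver}}\cong{}_A\mathrm{Hom}(\mathfrak{X}_{\mathrm{ver}},A)$ as right $H$-covariant first order differential calculi on $A$.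
   Context: $H^\circ$ is the finite dual Hopf algebra of $H$, $\Delta(u)(h\otimes g)=u(hg)$, unit $\varepsilon$. A quantum tangent space is a finite-dimensional $\mathfrak{g}\subset\{u\in H^\circ\mid u(1)=0\}$ with $\Delta(\mathfrak{g})\subset\mathfrak{g}\otimes\varepsilon+H^\circ\otimes\mathfrak{g}$; for a basis $\{\chi_i\}$ write $\Delta(\chi_i)=\chi_i\otimes\varepsilon+\sum_jf_i^j\otimes\chi_j$. It is bicovariant if $\mathrm{ad}_{\mathfrak{g}}(\chi)\colon h\mapsto h_1S(h_3)\chi(h_2)$ lies in $\mathfrak{g}\otimes H\subseteq\mathrm{End}_\Bbbk(H)$ (via $(\chi\otimes k)(h)=\chi(h)k$) for all $\chi\in\mathfrak{g}$; write $\mathrm{ad}_{\mathfrak{g}}(\chi_i)=\sum_j\chi_j\otimes N_i^j$. A first order vector field calculus (FOVC) on an algebra $A$ is a pair $(\mathfrak{X},\mathscr{L})$: $\mathfrak{X}$ an $A$-bimodule, $\mathscr{L}\colon\mathfrak{X}\to\mathrm{End}_\Bbbk(A)$ $\Bbbk$-linear, injective, left $A$-linear, with $\mathscr{L}_X(ab)=\mathscr{L}_X(a)b+\mathscr{L}_{X\cdot a}(b)$. A first order differential calculus (FODC) is $(\Gamma,\mathrm{d})$: $\Gamma$ an $A$-bimodule, $\mathrm{d}\colon A\to\Gamma$ linear with $\mathrm{d}(ab)=\mathrm{d}(a)b+a\mathrm{d}(b)$ and $\Gamma$ spanned by the $a\,\mathrm{d}b$. Covariance means compatible $H$-coactions on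 the bimodule (i.e. $\delta(a\cdot m\cdot a')=\delta_A(a)\delta(m)\delta_A(a')$) such that $X\otimes a\mapsto\mathscr{L}_X(a)$, respectively $\mathrm{d}$, is colinear; isomorphisms are colinear bimodule isomorphisms intertwining $\mathscr{L}$, respectively $\mathrm{d}$. Duality: $(\Gamma,\mathrm{d})\mapsto\mathrm{Hom}_A(\Gamma,A)$ (right $A$-linear maps, $(a\cdot X\cdot b)(\omega)=aX(b\omega)$, $\mathscr{L}_X(a)=X(\mathrm{d}a)$, coaction $X\mapsto X_0\otimes X_1$ with $X_0(\omega)\otimes X_1=X(\omega_0)_0\otimes X(\omega_0)_1S(\omega_1)$) and $(\mathfrak{X},\mathscr{L})\mapsto{}_A\mathrm{Hom}(\mathfrak{X},A)$ (left $A$-linear maps, $(a\cdot\omega\cdot b)(X)=\omega(X\cdot a)b$, $(\mathrm{d}a)(X)=\mathscr{L}_X(a)$, coaction $\omega\mapsto\omega_0\otimes\omega_1$ with $\omega_0(X)\otimes\omega_1=\omega(X_0)_0\otimes S^{-1}(X_1)\omega(X_0)_1$). The FOVC $H\otimes\mathfrak{g}$ on $H$ has $\mathscr{L}_{h\otimes\chi}(g)=hg_1\chi(g_2)$, actions $h'\cdot(h\otimes\chi_i)\cdot g=\sum_jh'hg_1f_i^j(g_2)\otimes\chi_j$, left coaction $h\otimes\chi\mapsto h_1\otimes h_2\otimes\chi$, right coaction $h\otimes\chi_i\mapsto\sum_jh_1\otimes\chi_j\otimes h_2N_i^j$. $\mathfrak{X}_{\mathrm{ver}}=A\otimes\mathfrak{g}$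 is the right $H$-covariant FOVC on $A$ with $a\cdot(a'\otimes\chi_i)\cdot a''=\sum_jaa'a''_0f_i^j(a''_1)\otimes\chi_j$, $\mathscr{L}_{a\otimes\chi}(a')=aa'_0\chi(a'_1)$ and coaction $a\otimes\chi_i\mapsto\sum_ja_0\otimes\chi_j\otimes a_1N_i^j$. $\Gamma_{\mathrm{ver}}=A\otimes\Lambda$ is the right $H$-covariant FODC on $A$ with left action by multiplication, right action $(a\otimes\vartheta)\cdot a'=aa'_0\otimes S(a'_1)\vartheta a'_2$, coaction $a\otimes\vartheta\mapsto a_0\otimes\vartheta_0\otimes a_1\vartheta_1$ (using the right $H$-coaction of $\Gamma$ restricted to $\Lambda$) and differential $\mathrm{d}(a)=a_0\otimes S(a_1)\mathrm{d}_H(a_2)$. Hopf--Galois means $A\otimes_BA\to A\otimes H$, $a\otimes_Ba'\mapsto aa'_0\otimes a'_1$, is bijective, where $\Delta_A(a)=a_0\otimes a_1$ and $B=\{a\mid\Delta_A(a)=a\otimes1\}$. The antipode of $H$ is assumed invertible. *)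

(* Defs.v *)
From HB Require Import structures.
From mathcomp Require Import all_boot all_order all_algebra.
From mathcomp Require Import generic_quotient boolp classical_sets functions.

Set Implicit Arguments.
Unset Strict Implicit.
Unset Printing Implicit Defensive.

Import GRing.Theory.
Local Open Scope ring_scope.
Local Open Scope quotient_scope.

(** [btensor r l] is the quotient of formal sums of pairs by the relation
    "every balanced bilinear map takes the same value". An element [t] has a
    chosen representative [legs t], so that Sweedler notation such as
    [h_1 S(h_2)] becomes [\sum_(p <- legs (comul hH h)) p.1 * antipode hH p.2].
    By [sum_legs_pi] such a sum does not depend on the representative as long
    as the summand is bilinear and balanced in [(p.1, p.2)]; all the sums over
    [legs] below are of this kind. *)

Definition bilinear_map (k : fieldType) (V W U : lmodType k)
    (f : V -> W -> U) : Prop :=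
  (forall v, linear (f v)) /\ (forall w, linear (f^~ w)).

Lemma linear_at0 (k : fieldType) (V W : lmodType k) (f : V -> W) :
  linear f -> f 0 = 0.
Proof. by move=> h; have := h (- 1) 0 0; rewrite scaler0 addr0 scaleN1r addNr. Qed.

Section BalancedTensor.
Variables (k : fieldType) (V W : lmodType k) (I : Type).
Variables (r : V -> I -> V) (l : I -> W -> W).

Definition balanced (U : lmodType k) (f : V -> W -> U) : Prop :=
  bilinear_map f /\ forall v i w, f (r v i) w = f v (l i w).

Definition same_tensor (s t : seq (V * W)) : bool :=
  `[< forall (U : lmodType k) (f : V -> W -> U), balanced f ->
        \sum_(p <- s) f p.1 p.2 = \sum_(p <- t) f p.1 p.2 >].

Lemma same_tensor_refl : reflexive same_tensor.
Proof. by move=> s; apply/asboolP. Qed.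

Lemma same_tensor_sym : symmetric same_tensor.
Proof.
by move=> s t; apply/asboolP/asboolP => h U f hf; rewrite (h U f hf).
Qed.

Lemma same_tensor_trans : transitive same_tensor.
Proof.
move=> t s u /asboolP h1 /asboolP h2; apply/asboolP => U f hf.
by rewrite (h1 U f hf) (h2 U f hf).
Qed.

Canonical same_tensor_equiv :=
  EquivRel same_tensor same_tensor_refl same_tensor_sym same_tensor_trans.

Definition btensor := {eq_quot same_tensor}.
HB.instance Definition _ := Choice.on btensor.
HB.instance Definition _ := Quotient.on btensor.

Definition legs (t : btensor) : seq (V * W) := repr t.
Definition bpure (v : V) (w : W) : btensor := \pi_btensor [:: (v, w)].

Lemma sum_legs_pi (U : lmodType k) (f : V -> W -> U) (s : seq (V * W)) :
  balanced f ->
  \sum_(p <- legs (\pi_btensor s)) f p.1 p.2 = \sum_(p <- s) f p.1 p.2.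
Proof.
move=> hf; have /eqmodP/asboolP h : legs (\pi_btensor s) = s %[mod btensor].
  by rewrite /legs reprK.
exact: h.
Qed.

Lemma btensor_ext (t u : btensor) :
  (forall (U : lmodType k) (f : V -> W -> U), balanced f ->
     \sum_(p <- legs t) f p.1 p.2 = \sum_(p <- legs u) f p.1 p.2) -> t = u.
Proof.
move=> h; rewrite -[t]reprK -[u]reprK; apply/eqmodP/asboolP => U f hf.
exact: h.
Qed.

Definition tadd (t u : btensor) : btensor := \pi_btensor (legs t ++ legs u).
Definition tscale (c : k) (t : btensor) : btensor :=
  \pi_btensor [seq (c *: p.1, p.2) | p <- legs t].
Definition topp (t : btensor) : btensor := tscale (- 1) t.
Definition tzero : btensor := \pi_btensor [::].

Lemma sum_tadd U f (t u : btensor) : @balanced U f ->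
  \sum_(p <- legs (tadd t u)) f p.1 p.2 =
  \sum_(p <- legs t) f p.1 p.2 + \sum_(p <- legs u) f p.1 p.2.
Proof. by move=> hf; rewrite sum_legs_pi // big_cat. Qed.

Lemma balancedZ (U : lmodType k) (f : V -> W -> U) c v w :
  balanced f -> f (c *: v) w = c *: f v w.
Proof.
move=> [[_ hf] _]; have := hf w c v 0.
by rewrite /= addr0 (linear_at0 (hf w)) addr0.
Qed.

Lemma sum_tscale U f c (t : btensor) : @balanced U f ->
  \sum_(p <- legs (tscale c t)) f p.1 p.2 = c *: \sum_(p <- legs t) f p.1 p.2.
Proof.
move=> hf; rewrite sum_legs_pi // big_map scaler_sumr.
by apply: eq_bigr => p _; rewrite /= balancedZ.
Qed.

Lemma sum_tzero U f : @balanced U f -> \sum_(p <- legs tzero) f p.1 p.2 = 0.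
Proof. by move=> hf; rewrite sum_legs_pi // big_nil. Qed.

Lemma taddA : associative tadd.
Proof. by move=> t u v; apply: btensor_ext => U f hf; rewrite !sum_tadd // addrA. Qed.
Lemma taddC : commutative tadd.
Proof. by move=> t u; apply: btensor_ext => U f hf; rewrite !sum_tadd // addrC. Qed.
Lemma tadd0 : left_id tzero tadd.
Proof. by move=> t; apply: btensor_ext => U f hf; rewrite sum_tadd // sum_tzero // add0r. Qed.
Lemma taddN : left_inverse tzero topp tadd.
Proof.
move=> t; apply: btensor_ext => U f hf.
by rewrite sum_tadd // sum_tzero // sum_tscale // scaleN1r addNr.
Qed.
HB.instance Definition _ := GRing.isZmodule.Build btensor taddA taddC tadd0 taddN.

Lemma tscaleA c d (t : btensor) : tscale c (tscale d t) = tscale (c * d) t.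
Proof. by apply: btensor_ext => U f hf; rewrite !sum_tscale // scalerA. Qed.
Lemma tscale1 : left_id 1 tscale.
Proof. by move=> t; apply: btensor_ext => U f hf; rewrite sum_tscale // scale1r. Qed.
Lemma tscaleDr : right_distributive tscale +%R.
Proof.
move=> c t u; apply: btensor_ext => U f hf.
by rewrite sum_tscale // !sum_tadd // !sum_tscale // scalerDr.
Qed.
Lemma tscaleDl (t : btensor) : {morph tscale^~ t : c d / c + d}.
Proof.
move=> c d; apply: btensor_ext => U f hf.
by rewrite sum_tadd // !sum_tscale // scalerDl.
Qed.
HB.instance Definition _ :=
  GRing.Zmodule_isLmodule.Build k btensor tscaleA tscale1 tscaleDr tscaleDl.

Lemma sum_legs_linear (U : lmodType k) (f : V -> W -> U) : balanced f ->
  linear (fun t : btensor => \sum_(p <- legs t) f p.1 p.2).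
Proof. by move=> hf c t u /=; rewrite sum_tadd // sum_tscale. Qed.

Lemma sum_legs_pure (U : lmodType k) (f : V -> W -> U) v w : balanced f ->
  \sum_(p <- legs (bpure v w)) f p.1 p.2 = f v w.
Proof. by move=> hf; rewrite sum_legs_pi // big_seq1. Qed.

Lemma bpure_balanced : balanced bpure.
Proof.
split; first split.
- move=> v c w w'; apply: btensor_ext => U f hf.
  rewrite sum_tadd // sum_tscale // !sum_legs_pi // !big_seq1 /=.
  by case: hf => -[hf _] _; rewrite hf.
- move=> w c v v'; apply: btensor_ext => U f hf.
  rewrite sum_tadd // sum_tscale // !sum_legs_pi // !big_seq1 /=.
  by case: hf => -[_ hf] _; rewrite (hf w).
- move=> v i w; apply: btensor_ext => U f hf.
  by rewrite !sum_legs_pi // !big_seq1 /=; case: hf.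
Qed.

Lemma sum_legs_bpure (t : btensor) : \sum_(p <- legs t) bpure p.1 p.2 = t.
Proof.
rewrite -[RHS]reprK -/(legs t); elim: (legs t) => [|p s ih].
  by rewrite big_nil.
rewrite big_cons ih; apply: btensor_ext => U f hf.
by rewrite sum_tadd // sum_legs_pure // !sum_legs_pi // big_cons.
Qed.

End BalancedTensor.

(** Over [k] itself, bilinearity is the only condition. *)
Definition tensor (k : fieldType) (V W : lmodType k) :=
  @btensor k V W void (fun v _ => v) (fun _ w => w).
HB.instance Definition _ (k : fieldType) (V W : lmodType k) :=
  GRing.Lmodule.on (tensor V W).

Definition pure (k : fieldType) (V W : lmodType k) (v : V) (w : W) :
  tensor V W := @bpure k V W void _ _ v w.

Notation "v ⊗ w" := (pure v w) (at level 40, left associativity) : ring_scope.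

Definition tensor_mul (k : fieldType) (A B : algType k) (s t : tensor A B) :
    tensor A B :=
  \sum_(p <- legs s) \sum_(q <- legs t) (p.1 * q.1) ⊗ (p.2 * q.2).

Section Subspace.
Variables (k : fieldType) (V : lmodType k).

Section Elements.
Variable S : submodClosed V.
Record subv := Subv { subval : V; _ : subval \in S }.
HB.instance Definition _ := [isSub for subval].
HB.instance Definition _ := [Choice of subv by <:].
HB.instance Definition _ := [SubChoice_isSubLmodule of subv by <:].
End Elements.

Section OfProp.
Variable P : V -> Prop.
Hypothesis P0 : P 0.
Hypothesis Plin : forall (c : k) u v, P u -> P v -> P (c *: u + v).

Definition subspace_pred : {pred V} := fun v => `[< P v >].

Lemma subspace_pred_closed : subsemimod_closed subspace_pred.
Proof.
split; first split.
- exact/asboolP.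
- move=> u v /asboolP hu /asboolP hv; apply/asboolP.
  by rewrite -[u]scale1r; apply: Plin.
- by move=> c u /asboolP hu; apply/asboolP; rewrite -[_ *: _]addr0; apply: Plin.
Qed.

End OfProp.

Definition subspace_of (P : V -> Prop) (P0 : P 0)
    (Plin : forall (c : k) u v, P u -> P v -> P (c *: u + v)) :
    submodClosed V :=
  HB.pack (subspace_pred P)
    (GRing.isAddClosed.Build V (subspace_pred P)
       (proj1 (subspace_pred_closed P0 Plin)))
    (GRing.isScaleClosed.Build k V (subspace_pred P)
       (proj2 (subspace_pred_closed P0 Plin))).

End Subspace.

(** The element [u] with [i u = v]. It is meant for an injective [i] and a [v]
    in its image, and regards an element of a space as an element of a
    subspace; if [v] is not in the image, the value is [0]. *)
Definition lift_along (k : fieldType) (U : lmodType k) (V : Type)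
    (i : U -> V) (v : V) : U :=
  xget 0 [set u | i u = v]%classic.

Definition finite_dim (k : fieldType) (V : lmodType k) : Prop :=
  exists (n : nat) (e : 'I_n -> V),
    forall v, exists c : 'I_n -> k, v = \sum_(i < n) c i *: e i.

Record hopf (k : fieldType) (H : algType k) := Hopf {
  comul : H -> tensor H H;
  counit : H -> k;
  antipode : H -> H;
  comul_linear : linear comul;
  counit_linear : scalar counit;
  antipode_linear : linear antipode;
  comulA : forall h,
    \sum_(p <- legs (comul h)) \sum_(q <- legs (comul p.1)) q.1 ⊗ q.2 ⊗ p.2 =
    \sum_(p <- legs (comul h)) \sum_(q <- legs (comul p.2)) p.1 ⊗ q.1 ⊗ q.2;
  counitl : forall h, \sum_(p <- legs (comul h)) counit p.1 *: p.2 = h;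
  counitr : forall h, \sum_(p <- legs (comul h)) counit p.2 *: p.1 = h;
  comul1 : comul 1 = 1 ⊗ 1;
  comulM : forall h g, comul (h * g) = tensor_mul (comul h) (comul g);
  counit1 : counit 1 = 1;
  counitM : forall h g, counit (h * g) = counit h * counit g;
  antipodel : forall h,
    \sum_(p <- legs (comul h)) antipode p.1 * p.2 = counit h *: 1;
  antipoder : forall h,
    \sum_(p <- legs (comul h)) p.1 * antipode p.2 = counit h *: 1
}.

Section Comodules.
Variables (k : fieldType) (H : algType k) (hH : hopf H).

Record is_rcomodule (V : lmodType k) (delta : V -> tensor V H) : Prop := {
  rcoact_linear : linear delta;
  rcoactA : forall v,
    \sum_(p <- legs (delta v)) \sum_(q <- legs (delta p.1)) q.1 ⊗ q.2 ⊗ p.2 =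
    \sum_(p <- legs (delta v)) \sum_(q <- legs (comul hH p.2))
      p.1 ⊗ q.1 ⊗ q.2;
  rcoact_counit : forall v,
    \sum_(p <- legs (delta v)) counit hH p.2 *: p.1 = v
}.

Record is_lcomodule (V : lmodType k) (delta : V -> tensor H V) : Prop := {
  lcoact_linear : linear delta;
  lcoactA : forall v,
    \sum_(p <- legs (delta v)) \sum_(q <- legs (comul hH p.1))
      q.1 ⊗ q.2 ⊗ p.2 =
    \sum_(p <- legs (delta v)) \sum_(q <- legs (delta p.2)) p.1 ⊗ q.1 ⊗ q.2;
  lcoact_counit : forall v,
    \sum_(p <- legs (delta v)) counit hH p.1 *: p.2 = v
}.

Record comodule_algebra (A : algType k) := ComoduleAlgebra {
  coact : A -> tensor A H;
  coact_rcomodule : is_rcomodule coact;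
  coact1 : coact 1 = 1 ⊗ 1;
  coactM : forall a b, coact (a * b) = tensor_mul (coact a) (coact b)
}.

Definition self_comodule_algebra : comodule_algebra H :=
  ComoduleAlgebra
    (Build_is_rcomodule (comul_linear hH) (comulA hH) (counitr hH))
    (comul1 hH) (comulM hH).

Section HopfGalois.
Variables (A : algType k) (cA : comodule_algebra A).

Definition coinvariant_subalgebra := {b : A | coact cA b = b ⊗ 1}.

Definition tensor_over_coinvariants :=
  @btensor k A A coinvariant_subalgebra
    (fun a b => a * sval b) (fun b a => sval b * a).

Definition canonical_map (t : tensor_over_coinvariants) : tensor A H :=
  \sum_(p <- legs t) \sum_(q <- legs (coact cA p.2)) (p.1 * q.1) ⊗ q.2.

Definition hopf_galois : Prop := bijective canonical_map.
End HopfGalois.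
End Comodules.

(** [RFOVC] and [RFODC] stand for right [H]-covariant first order vector field
    calculi and first order differential calculi, [BiFOVC] and [BiFODC] for
    bicovariant ones on [H]. These records and [Bimodule] hold structure maps
    only; the axioms are in the predicates [is_bimodule], [is_rfovc], etc. *)

Section Calculi.
Variables (k : fieldType) (H : algType k) (hH : hopf H).

Record Bimodule (A : algType k) := MkBimodule {
  bm_space :> lmodType k;
  lact : A -> bm_space -> bm_space;
  ract : bm_space -> A -> bm_space
}.

Record is_bimodule (A : algType k) (M : Bimodule A) : Prop := {
  lact_bilinear : bilinear_map (@lact A M);
  ract_bilinear : bilinear_map (@ract A M);
  lact1 : forall m : M, lact 1 m = m;
  lactM : forall a b (m : M), lact (a * b) m = lact a (lact b m);
  ract1 : forall m : M, ract m 1 = m;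
  ractM : forall a b (m : M), ract m (a * b) = ract (ract m a) b;
  lract : forall a b (m : M), ract (lact a m) b = lact a (ract m b)
}.

Section RightCovariant.
Variables (A : algType k) (cA : comodule_algebra hH A).

Record RFOVC := MkRFOVC {
  rfovc_bm :> Bimodule A;
  lie : rfovc_bm -> A -> A;
  vf_rcoact : rfovc_bm -> tensor rfovc_bm H
}.

Record RFODC := MkRFODC {
  rfodc_bm :> Bimodule A;
  diff : A -> rfodc_bm;
  form_rcoact : rfodc_bm -> tensor rfodc_bm H
}.

Record is_rcovariant_bimodule (M : Bimodule A) (delta : M -> tensor M H) :
    Prop := {
  rcov_bimodule : is_bimodule M;
  rcov_comodule : is_rcomodule hH delta;
  rcov_compat : forall a (m : M) b,
    delta (ract (lact a m) b) =
    \sum_(p <- legs (coact cA a)) \sum_(q <- legs (delta m))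
      \sum_(r <- legs (coact cA b))
        ract (lact p.1 q.1) r.1 ⊗ (p.2 * q.2 * r.2)
}.

Record is_rfovc (X : RFOVC) : Prop := {
  rfovc_rcov : is_rcovariant_bimodule (@vf_rcoact X);
  lie_bilinear : bilinear_map (@lie X);
  lie_inj : injective (@lie X);
  lie_lact : forall a (x : X) b, lie (lact a x) b = a * lie x b;
  lie_leibniz : forall (x : X) a b,
    lie x (a * b) = lie x a * b + lie (ract x a) b;
  lie_rcolinear : forall (x : X) a,
    coact cA (lie x a) =
    \sum_(p <- legs (vf_rcoact x)) \sum_(q <- legs (coact cA a))
      lie p.1 q.1 ⊗ (p.2 * q.2)
}.

Record is_rfodc (G : RFODC) : Prop := {
  rfodc_rcov : is_rcovariant_bimodule (@form_rcoact G);
  diff_linear : linear (@diff G);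
  diff_leibniz : forall a b,
    diff G (a * b) = ract (diff G a) b + lact a (diff G b);
  diff_span : forall w : G, exists s : seq (A * A),
    w = \sum_(p <- s) lact p.1 (diff G p.2);
  diff_rcolinear : forall a,
    form_rcoact (diff G a) = \sum_(p <- legs (coact cA a)) diff G p.1 ⊗ p.2
}.

Record is_bimodule_iso (M N : Bimodule A) (Phi : M -> N) : Prop := {
  bimodule_iso_linear : linear Phi;
  bimodule_iso_bij : bijective Phi;
  bimodule_iso_act : forall a m b,
    Phi (ract (lact a m) b) = ract (lact a (Phi m)) b
}.

Record is_rfovc_iso (X Y : RFOVC) (Phi : X -> Y) : Prop := {
  rfovc_iso_bimodule : is_bimodule_iso Phi;
  rfovc_iso_lie : forall x a, lie (Phi x) a = lie x a;
  rfovc_iso_rcolinear : forall x,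
    vf_rcoact (Phi x) = \sum_(p <- legs (vf_rcoact x)) Phi p.1 ⊗ p.2
}.

Record is_rfodc_iso (G K : RFODC) (Phi : G -> K) : Prop := {
  rfodc_iso_bimodule : is_bimodule_iso Phi;
  rfodc_iso_diff : forall a, Phi (diff G a) = diff K a;
  rfodc_iso_rcolinear : forall w,
    form_rcoact (Phi w) = \sum_(p <- legs (form_rcoact w)) Phi p.1 ⊗ p.2
}.

Definition rfovc_isomorphic (X Y : RFOVC) : Prop :=
  [/\ is_rfovc X, is_rfovc Y & exists Phi : X -> Y, is_rfovc_iso Phi].

Definition rfodc_isomorphic (G K : RFODC) : Prop :=
  [/\ is_rfodc G, is_rfodc K & exists Phi : G -> K, is_rfodc_iso Phi].

Definition is_rhom (M : Bimodule A) (f : M -> A) : Prop :=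
  linear f /\ forall m a, f (ract m a) = f m * a.

Lemma is_rhom0 (M : Bimodule A) : is_rhom (0 : M -> A).
Proof.
split=> [c u v|m a]; last by rewrite [LHS]/(0 : A) [X in X * a]/(0 : A) mul0r.
by rewrite [X in _ = c *: X + _]/(0 : A) scaler0 add0r.
Qed.

Lemma is_rhom_lin (M : Bimodule A) (c : k) (f g : M -> A) :
  is_rhom f -> is_rhom g -> is_rhom (c *: f + g).
Proof.
move=> [fl fr] [gl gr]; split=> [d u v|m a].
  rewrite !fctE fl gl !scalerDr !scalerA addrACA [c * d]mulrC.
  by [].
by rewrite !fctE fr gr mulrDl scalerAl.
Qed.

Definition rHom (M : Bimodule A) : submodClosed (M -> A) :=
  subspace_of (@is_rhom0 M) (@is_rhom_lin M).

Definition is_lhom (M : Bimodule A) (f : M -> A) : Prop :=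
  linear f /\ forall a m, f (lact a m) = a * f m.

Lemma is_lhom0 (M : Bimodule A) : is_lhom (0 : M -> A).
Proof.
split=> [c u v|a m]; last by rewrite [LHS]/(0 : A) [X in a * X]/(0 : A) mulr0.
by rewrite [X in _ = c *: X + _]/(0 : A) scaler0 add0r.
Qed.

Lemma is_lhom_lin (M : Bimodule A) (c : k) (f g : M -> A) :
  is_lhom f -> is_lhom g -> is_lhom (c *: f + g).
Proof.
move=> [fl fr] [gl gr]; split=> [d u v|a m].
  rewrite !fctE fl gl !scalerDr !scalerA addrACA [c * d]mulrC.
  by [].
by rewrite !fctE fr gr mulrDr scalerAr.
Qed.

Definition lHom (M : Bimodule A) : submodClosed (M -> A) :=
  subspace_of (@is_lhom0 M) (@is_lhom_lin M).

Definition rHom_bimodule (M : Bimodule A) : Bimodule A :=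
  @MkBimodule A (subv (rHom M))
    (fun a X => lift_along val (fun w => a * val X w))
    (fun X b => lift_along val (fun w => val X (lact b w))).

Definition lHom_bimodule (M : Bimodule A) : Bimodule A :=
  @MkBimodule A (subv (lHom M))
    (fun a w => lift_along val (fun X => val w (ract X a)))
    (fun w b => lift_along val (fun X => val w X * b)).

(** The embedding of [Hom(M, A) ⊗ H] into the functions [M -> A ⊗ H]. *)
Definition eval_tensor (M : Type) (F : lmodType k) (ev : F -> M -> A)
    (t : tensor F H) : M -> tensor A H :=
  fun m => \sum_(p <- legs t) ev p.1 m ⊗ p.2.

Definition dual_of_rfodc (G : RFODC) : RFOVC :=
  @MkRFOVC (rHom_bimodule G)
    (fun X a => val X (diff G a))
    (fun X => lift_along (eval_tensor (fun Y : subv (rHom G) => val Y))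
      (fun w => \sum_(p <- legs (form_rcoact w))
                  \sum_(q <- legs (coact cA (val X p.1)))
                    q.1 ⊗ (q.2 * antipode hH p.2))).

(** [Sinv] is the inverse of the antipode. *)
Definition dual_of_rfovc (Sinv : H -> H) (X : RFOVC) : RFODC :=
  @MkRFODC (lHom_bimodule X)
    (fun a => lift_along val (fun x : X => lie x a))
    (fun w => lift_along (eval_tensor (fun z : subv (lHom X) => val z))
      (fun x => \sum_(p <- legs (vf_rcoact x))
                  \sum_(q <- legs (coact cA (val w p.1)))
                    q.1 ⊗ (Sinv p.2 * q.2))).

End RightCovariant.

Local Notation cH := (self_comodule_algebra hH).

Record BiFOVC := MkBiFOVC {
  bifovc_r :> RFOVC H;
  vf_lcoact : bifovc_r -> tensor H bifovc_r
}.

Record BiFODC := MkBiFODC {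
  bifodc_r :> RFODC H;
  form_lcoact : bifodc_r -> tensor H bifodc_r
}.

Record is_bifodc (G : BiFODC) : Prop := {
  bifodc_rfodc : is_rfodc cH G;
  form_lcomodule : is_lcomodule hH (@form_lcoact G);
  form_bicomodule : forall w : G,
    \sum_(p <- legs (form_rcoact w)) \sum_(q <- legs (form_lcoact p.1))
      q.1 ⊗ q.2 ⊗ p.2 =
    \sum_(p <- legs (form_lcoact w)) \sum_(q <- legs (form_rcoact p.2))
      p.1 ⊗ q.1 ⊗ q.2;
  form_lcompat : forall a (w : G) b,
    form_lcoact (ract (lact a w) b) =
    \sum_(p <- legs (comul hH a)) \sum_(q <- legs (form_lcoact w))
      \sum_(r <- legs (comul hH b))
        (p.1 * q.1 * r.1) ⊗ ract (lact p.2 q.2) r.2;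
  diff_lcolinear : forall a,
    form_lcoact (diff G a) = \sum_(p <- legs (comul hH a)) p.1 ⊗ diff G p.2
}.

Record is_bifodc_iso (G K : BiFODC) (Phi : G -> K) : Prop := {
  bifodc_iso_r : is_rfodc_iso Phi;
  bifodc_iso_lcolinear : forall w,
    form_lcoact (Phi w) = \sum_(p <- legs (form_lcoact w)) p.1 ⊗ Phi p.2
}.

Definition coeval_tensor (M : Type) (F : lmodType k) (ev : F -> M -> H)
    (t : tensor H F) : M -> tensor H H :=
  fun m => \sum_(p <- legs t) p.1 ⊗ ev p.2 m.

(** The left coaction of the dual is the mirror image of the right one,
    [w_{-1} ⊗ w_0(X) = S(X_{-1}) w(X_0)_{-1} ⊗ w(X_0)_0]; here it is the
    antipode itself that makes [w_0] left [H]-linear. *)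
Definition dual_of_bifovc (Sinv : H -> H) (X : BiFOVC) : BiFODC :=
  @MkBiFODC (dual_of_rfovc cH Sinv X)
    (fun w => lift_along (coeval_tensor (fun z : subv (lHom X) => val z))
      (fun x => \sum_(p <- legs (vf_lcoact x))
                  \sum_(q <- legs (comul hH (val w p.2)))
                    (antipode hH p.1 * q.1) ⊗ q.2)).

Section Coinvariant.
Variables (G : BiFODC) (hG : is_bifodc G).

Definition is_coinv (w : G) : Prop := form_lcoact w = 1 ⊗ w.

Lemma coinv0 : is_coinv 0.
Proof.
have h := lcoact_linear (form_lcomodule hG).
have [[pl _] _] := @bpure_balanced k H G void (fun v _ => v) (fun _ w => w).
by rewrite /is_coinv /pure (linear_at0 h) (linear_at0 (pl 1)).
Qed.

Lemma coinv_lin (c : k) (u v : G) :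
  is_coinv u -> is_coinv v -> is_coinv (c *: u + v).
Proof.
have h := lcoact_linear (form_lcomodule hG).
have [[pl _] _] := @bpure_balanced k H G void (fun v _ => v) (fun _ w => w).
by rewrite /is_coinv => hu hv; rewrite h hu hv /pure pl.
Qed.

Definition left_coinvariants : submodClosed G := subspace_of coinv0 coinv_lin.
End Coinvariant.

Definition is_linear_form (u : H -> k^o) : Prop := linear u.

Lemma linear_form0 : is_linear_form 0.
Proof. by move=> c u v; rewrite [X in _ = c *: X + _]/(0 : k^o) scaler0 add0r. Qed.

Lemma linear_form_lin (c : k) (f g : H -> k^o) :
  is_linear_form f -> is_linear_form g -> is_linear_form (c *: f + g).
Proof.
move=> fl gl d u v; rewrite !fctE fl gl !scalerDr !scalerA addrACA [c * d]mulrC.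
by [].
Qed.

Definition linear_dual : submodClosed (H -> k^o) :=
  subspace_of linear_form0 linear_form_lin.

(** The embedding of [V ⊗ W], for spaces [V], [W] of linear forms, into the
    functions of two variables; [Delta(u)] in [V ⊗ W] means that
    [u (h * g) = eval2 t h g] for some [t]. *)
Definition eval2 (V W : submodClosed (H -> k^o)) (t : tensor (subv V) (subv W))
    (h g : H) : k^o :=
  \sum_(p <- legs t) val p.1 h * val p.2 g.

Definition is_finite_dual (u : H -> k^o) : Prop :=
  u \in linear_dual /\
  exists t : tensor (subv linear_dual) (subv linear_dual),
    forall h g, u (h * g) = eval2 t h g.

Lemma eval2_linear (V W : submodClosed (H -> k^o)) h g :
  linear (fun t : tensor (subv V) (subv W) => eval2 t h g).
Proof.
apply: (@sum_legs_linear k (subv V) (subv W) void _ _ k^o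
  (fun v w => val v h * val w g)); split=> //; split=> [v|w] c u u' /=.
- by rewrite mulrDr -scalerAr.
- by rewrite mulrDl -scalerAl.
Qed.

Lemma finite_dual0 : is_finite_dual 0.
Proof.
split; first exact/asboolP/linear_form0.
by exists 0 => h g; rewrite (linear_at0 (eval2_linear h g)).
Qed.

Lemma finite_dual_lin (c : k) (f g : H -> k^o) :
  is_finite_dual f -> is_finite_dual g -> is_finite_dual (c *: f + g).
Proof.
move=> [/asboolP fl [t ft]] [/asboolP gl [u gu]]; split.
  exact/asboolP/linear_form_lin.
by exists (c *: t + u) => h h'; rewrite eval2_linear -ft -gu.
Qed.

Definition finite_dual : submodClosed (H -> k^o) :=
  subspace_of finite_dual0 finite_dual_lin.

Record is_quantum_tangent_space (T : submodClosed (H -> k^o)) : Prop := {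
  qts_finite_dim : finite_dim (subv T);
  qts_finite_dual : forall chi, chi \in T -> chi \in finite_dual;
  qts_unit : forall chi, chi \in T -> chi 1 = 0;
  qts_comul : forall chi, chi \in T ->
    exists2 chi', chi' \in T &
    exists t : tensor (subv finite_dual) (subv T),
      forall h g, chi (h * g) = chi' h * counit hH g + eval2 t h g
}.

Definition adjoint (chi : H -> k^o) (h : H) : H :=
  \sum_(p <- legs (comul hH h)) \sum_(q <- legs (comul hH p.2))
    (chi q.1 : k) *: (p.1 * antipode hH q.2).

Definition End_of_tensor (T : submodClosed (H -> k^o)) (t : tensor (subv T) H)
    (h : H) : H :=
  \sum_(p <- legs t) (val p.1 h : k) *: p.2.

Definition bicovariant_qts (T : submodClosed (H -> k^o)) : Prop :=
  forall chi, chi \in T ->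
    exists t : tensor (subv T) H, adjoint chi = End_of_tensor t.

Section TangentSpace.
Variable T : submodClosed (H -> k^o).

(** The element [Delta chi - chi ⊗ eps] of [H° ⊗ T]; in terms of a basis
    [chi_i] of [T], it is [\sum_j f_i^j ⊗ chi_j] for [chi = chi_i]. *)
Definition qts_coeff (chi : subv T) : tensor (subv finite_dual) (subv T) :=
  lift_along (@eval2 finite_dual T)
    (fun h g => val chi (h * g) - val chi h * counit hH g).

(** The element [ad(chi)] of [T ⊗ H]; in terms of a basis [chi_i] of [T], it is
    [\sum_j chi_j ⊗ N_i^j] for [chi = chi_i]. *)
Definition qts_ad (chi : subv T) : tensor (subv T) H :=
  lift_along (@End_of_tensor T) (adjoint (val chi)).

Section Vertical.
Variables (A : algType k) (cA : comodule_algebra hH A).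

Definition vertical_fields : RFOVC A :=
  @MkRFOVC A
    (@MkBimodule A (tensor A (subv T))
      (fun a x => \sum_(p <- legs x) (a * p.1) ⊗ p.2)
      (fun x a => \sum_(p <- legs x) \sum_(q <- legs (coact cA a))
                    \sum_(r <- legs (qts_coeff p.2))
                      ((val r.1 q.2 : k) *: (p.1 * q.1)) ⊗ r.2))
    (fun x a => \sum_(p <- legs x) \sum_(q <- legs (coact cA a))
                  (val p.2 q.2 : k) *: (p.1 * q.1))
    (fun x => \sum_(p <- legs x) \sum_(q <- legs (coact cA p.1))
                \sum_(r <- legs (qts_ad p.2))
                  q.1 ⊗ r.1 ⊗ (q.2 * r.2)).

End Vertical.

(** The calculus [H ⊗ T] on [H]: apart from the left coaction, its structure
    maps are those of [vertical_fields] for [A = H]. *)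
Definition tangent_bifovc : BiFOVC :=
  @MkBiFOVC (vertical_fields cH)
    (fun x => \sum_(p <- legs x) \sum_(q <- legs (comul hH p.1))
                q.1 ⊗ (q.2 ⊗ p.2)).

End TangentSpace.

Section VerticalForms.
Variables (A : algType k) (cA : comodule_algebra hH A).
Variables (G : BiFODC) (hG : is_bifodc G).

Local Notation Lambda := (subv (left_coinvariants hG)).

Definition coinv_ract (w : Lambda) (h : H) : Lambda :=
  lift_along val (\sum_(p <- legs (comul hH h))
                    ract (lact (antipode hH p.1) (val w)) p.2).

Definition maurer_cartan (h : H) : Lambda :=
  lift_along val (\sum_(p <- legs (comul hH h))
                    lact (antipode hH p.1) (diff G p.2)).

Definition coinv_rcoact (w : Lambda) : tensor Lambda H :=
  lift_along
    (fun t : tensor Lambda H =>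
       \sum_(p <- legs t) val p.1 ⊗ p.2 : tensor G H)
    (form_rcoact (val w)).

Definition vertical_forms : RFODC A :=
  @MkRFODC A
    (@MkBimodule A (tensor A Lambda)
      (fun a x => \sum_(p <- legs x) (a * p.1) ⊗ p.2)
      (fun x a => \sum_(p <- legs x) \sum_(q <- legs (coact cA a))
                    (p.1 * q.1) ⊗ coinv_ract p.2 q.2))
    (fun a => \sum_(p <- legs (coact cA a)) p.1 ⊗ maurer_cartan p.2)
    (fun x => \sum_(p <- legs x) \sum_(q <- legs (coact cA p.1))
                \sum_(r <- legs (coinv_rcoact p.2))
                  q.1 ⊗ r.1 ⊗ (q.2 * r.2)).

End VerticalForms.
End Calculi.

Definition perfect_pairing (k : fieldType) (V W : lmodType k)
    (b : V -> W -> k^o) : Prop :=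
  [/\ bilinear_map b,
      forall f : W -> k^o, linear f -> exists! v, b v = f
    & forall f : V -> k^o, linear f -> exists! w, b^~ w = f].

(* Main.v *)
Require Import Defs.
From mathcomp Require Import all_boot all_order all_algebra.
From mathcomp Require Import boolp classical_sets functions.

Set Implicit Arguments.
Unset Strict Implicit.
Unset Printing Implicit Defensive.

Import GRing.Theory.
Local Open Scope ring_scope.

(** The vertical calculi are dual because they are linked by one pairing
    B : X × Y -> A between X = A ⊗ g and Y = A ⊗ Λ, namely
    B (x, a ⊗ θ) = B_θ (x · a) with B_θ (a' ⊗ χ) = a' b(θ, χ), where
    b : Λ × g -> k is the pairing of left coinvariant forms with tangent
    vectors. The right action of A on X enters because a module of right linear
    maps on Y takes the left action of A on Y to the right action on X.

    In general ([fields_dual], [forms_dual]), let a calculus of fields X and a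
    calculus of forms Y have a bilinear pairing with B (x a, w) = B (x, a w),
    B (a x, w) = a B (x, w) and B (x, da) = L_x(a). Right linearity in w and
    colinearity follow, since Y is spanned by the forms a db and X satisfies the
    Leibniz rule. If moreover there are finitely many pairs (x_j, w_j) with
    x = sum_j B (x, w_j) x_j and w = sum_j w_j B (x_j, w), then x |-> B (x, -)
    and w |-> B (-, w) are isomorphisms onto the duals: the dual basis gives the
    inverses and shows that elements of Hom ⊗ H are determined by their values.

    The axioms of the two calculi are proved with little computation. A field is
    determined by its Lie derivative, so bimodule and comodule axioms for X may
    be tested on functions ([rfovc_of_lie]); the required injectivity, with
    values in A ⊗ W for any W, is where the Hopf-Galois condition enters, in the
    form that 1 ⊗ h is a sum of elements a_0 a' ⊗ a_1 ([galois_translation]). A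
    form is a sum of a db, so the comodule axioms and covariance of Y may be
    tested on these ([rcovariant_of_diff]); spanning is again the Hopf-Galois
    condition.

    On H itself the map P(w) = S(w_{-1}) w_0 projects the bicovariant calculus
    onto Λ. The Maurer-Cartan form is ϖ(h) = P(dh), the right action of H on Λ is
    θ ◁ h = P(θ h), and P(a w) = ε(a) P(w) makes every coinvariant form a
    Maurer-Cartan form. The isomorphism Phi gives b(ϖ(h), χ) = - χ(S(h))
    ([coinv_pairing_maurer_cartan]). This is nondegenerate in χ since S is onto
    and in θ since Phi is injective, so b is perfect, g being finite-dimensional.
    The same formula yields B (1 ⊗ χ, da) = a_0 χ(a_1), because
    f^j(h_1) χ_j(S(h_2)) = χ(h_1 S(h_2)) - χ(h) = - χ(h) when
    Δ(χ) = χ ⊗ ε + sum_j f^j ⊗ χ_j. *)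

(** * Multilinear maps on tensors *)

(** Sweedler sums, with the summand given as a function of the two legs, so
    that reassociation lemmas can be applied by rewriting. *)
Definition sw (k : fieldType) (V W U : lmodType k) (t : tensor V W)
    (f : V -> W -> U) : U :=
  \sum_(p <- legs t) f p.1 p.2.

Notation "\sw_ ( x , y <- t ) E" := (sw t (fun x y => E))
  (at level 41, x binder, y binder, E at level 41,
   format "'[' \sw_ ( x ,  y  <-  t ) '/  '  E ']'") : ring_scope.

Section Linear.
Variable k : fieldType.
Implicit Types (V W U X : lmodType k).

Lemma lin_id X : linear (fun x : X => x).
Proof. by []. Qed.

Lemma lin0 X U : linear (fun _ : X => 0 : U).
Proof. by move=> c u v; rewrite scaler0 addr0. Qed.

Lemma lin_comp X V U (f : V -> U) (g : X -> V) :
  linear f -> linear g -> linear (fun x => f (g x)).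
Proof. by move=> hf hg c u v; rewrite hg hf. Qed.

Lemma lin_bil_l X V W U (f : V -> W -> U) (g : X -> V) w :
  bilinear_map f -> linear g -> linear (fun x => f (g x) w).
Proof. by move=> [_ hf] hg c u v; rewrite hg (hf w). Qed.

Lemma lin_bil_r X V W U (f : V -> W -> U) (g : X -> W) v :
  bilinear_map f -> linear g -> linear (fun x => f v (g x)).
Proof. by move=> [hf _] hg c u u'; rewrite hg (hf v). Qed.

Lemma lin_add X U (f g : X -> U) :
  linear f -> linear g -> linear (fun x => f x + g x).
Proof. by move=> hf hg c u v; rewrite hf hg scalerDr addrACA. Qed.

Lemma lin_opp X U (f : X -> U) : linear f -> linear (fun x => - f x).
Proof. by move=> hf c u v; rewrite hf opprD scalerN. Qed.

Lemma lin_sum X U (I : Type) (s : seq I) (f : X -> I -> U) :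
  (forall i, linear (f^~ i)) -> linear (fun x => \sum_(i <- s) f x i).
Proof.
move=> hf c u v; rewrite scaler_sumr -big_split /=.
by apply: eq_bigr => i _; rewrite (hf i).
Qed.

Lemma lin_scalel X U (g : X -> k^o) (v : U) :
  linear g -> linear (fun x => (g x : k) *: v).
Proof. by move=> hg c u u'; rewrite hg scalerDl scalerA. Qed.

Lemma lin_scaler X U (g : X -> U) (c : k) :
  linear g -> linear (fun x => c *: g x).
Proof. by move=> hg d u u'; rewrite hg scalerDr !scalerA mulrC. Qed.

Lemma bil_balanced V W U (f : V -> W -> U) :
  bilinear_map f -> @balanced k V W void (fun v _ => v) (fun _ w => w) U f.
Proof. by []. Qed.

Lemma lin_sw V W U (f : V -> W -> U) : bilinear_map f -> linear (fun t => sw t f).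
Proof. by move=> hf; apply: (sum_legs_linear (bil_balanced hf)). Qed.

Lemma lin_sw_tensor X V W U (f : V -> W -> U) (t : X -> tensor V W) :
  bilinear_map f -> linear t -> linear (fun x => sw (t x) f).
Proof. by move=> hf ht; apply: (lin_comp (lin_sw hf) ht). Qed.

Lemma lin_sw_body X V W U (t : tensor V W) (f : X -> V -> W -> U) :
  (forall v w, linear (fun x => f x v w)) -> linear (fun x => sw t (f x)).
Proof. by move=> hf; apply: (@lin_sum _ _ _ _ (fun x p => f x p.1 p.2)) => p. Qed.

Lemma bil_pure V W : bilinear_map (@pure k V W).
Proof. by have [] := @bpure_balanced k V W void (fun v _ => v) (fun _ w => w). Qed.

Lemma bil_mul (A : algType k) : bilinear_map (@GRing.mul A).
Proof.
by split=> a c u v /=; rewrite ?mulrDr ?mulrDl -?scalerAr -?scalerAl.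
Qed.

Lemma lin_val V (S : submodClosed V) : linear (val : subv S -> V).
Proof. by move=> c u v; rewrite linearP. Qed.

Lemma lin_val_comp X V (S : submodClosed V) (g : X -> subv S) :
  linear g -> linear (fun x => val (g x)).
Proof. exact: (lin_comp (lin_val (S := S))). Qed.

Lemma lin_valapp (I : Type) V (S : submodClosed (I -> V)) i :
  linear (fun f : subv S => val f i).
Proof. by move=> c u v; rewrite linearP. Qed.

Lemma lin_valapp_comp X (I : Type) V (S : submodClosed (I -> V)) i
    (g : X -> subv S) : linear g -> linear (fun x => val (g x) i).
Proof. exact: (lin_comp (lin_valapp (S := S) i)). Qed.

End Linear.

Lemma lin_counit (k : fieldType) (H : algType k) (hH : hopf H) :
  linear (counit hH : H -> k^o).
Proof. exact: counit_linear. Qed.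

Lemma lin_counit_comp (k : fieldType) (H : algType k) (hH : hopf H)
    (X : lmodType k) (g : X -> H) :
  linear g -> linear (fun x => counit hH (g x) : k^o).
Proof. exact: (lin_comp (lin_counit hH)). Qed.

Lemma lin_form_comp (k : fieldType) (H : lmodType k)
    (S : submodClosed (H -> k^o)) (f : subv S) (X : lmodType k) (g : X -> H) :
  linear (val f : H -> k^o) -> linear g -> linear (fun x => val f (g x) : k^o).
Proof. exact: lin_comp. Qed.

Create HintDb lin.
#[global] Hint Extern 0 (bilinear_map (@pure _ _ _)) => exact: bil_pure : lin.
#[global] Hint Extern 0 (bilinear_map (@GRing.mul _)) => exact: bil_mul : lin.
#[global] Hint Extern 0 (GRing.linear_for _ (comul _)) =>
  exact: comul_linear : lin.
#[global] Hint Extern 0 (GRing.linear_for _ (counit _)) =>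
  exact: lin_counit : lin.
#[global] Hint Extern 0 (GRing.linear_for _ (antipode _)) =>
  exact: antipode_linear : lin.

(** Proves that a function is linear or bilinear by recursion on its body. The
    body may use the variable once in each summand, under operations that are
    known to be linear in that argument from the database or the context. *)
Ltac lin :=
  lazymatch goal with
  | |- bilinear_map _ => first [solve [auto 2 with lin] | split; intro; lin]
  | |- GRing.linear_for _ ?f =>
    let f' := eval cbv beta in (fun x => f x) in
    lazymatch f' with
    | (fun x => x) => apply: lin_id
    | (fun x => 0) => apply: lin0
    | (fun x => @?f x + @?g x) =>
        apply: (@lin_add _ _ _ f g); lin
    | (fun x => - @?f x) => apply: (@lin_opp _ _ _ f); lin
    | (fun x => bigop.body 0 ?s (fun i => bigop.BigBody i _ true (@?f x i))) =>
        apply: (@lin_sum _ _ _ _ s f); let i := fresh in intro i; cbv beta; lin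
    | _ =>
      (* A pattern variable may match a subterm that contains the bound
         variable, so a failing branch has to fall through to the next. *)
      match f' with
      | (fun x => sw ?t (@?f x)) =>
          apply: (@lin_sw_body _ _ _ _ _ t f);
          let a := fresh in let b := fresh in intros a b; cbv beta; lin
      | (fun x => sw (@?t x) ?f) =>
          apply: (@lin_sw_tensor _ _ _ _ _ f t); lin
      | (fun x => ?c *: (@?g x)) => apply: (@lin_scaler _ _ _ g c); lin
      | (fun x => (@?g x) *: ?v) => apply: (@lin_scalel _ _ _ g v); lin
      | (fun x => @isSub.val_subdef _ _ _ _ (@?g x) ?h) =>
          apply: (@lin_valapp_comp _ _ _ _ _ h g); lin
      | (fun x => @isSub.val_subdef _ _ _ _ ?f (@?g x)) =>
          apply: (@lin_form_comp _ _ _ f _ g); [solve [auto 2 with lin] | lin]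
      | (fun x => @isSub.val_subdef _ _ _ _ (@?g x)) =>
          apply: (@lin_val_comp _ _ _ _ g); lin
      | (fun x => counit ?hH (@?g x)) =>
          apply: (@lin_counit_comp _ _ hH _ g); lin
      | (fun x => ?f ?v (@?g x)) =>
          apply: (@lin_bil_r _ _ _ _ _ f g v);
          [solve [auto 2 with lin] | lin]
      | (fun x => ?f (@?g x) ?w) =>
          apply: (@lin_bil_l _ _ _ _ _ f g w);
          [solve [auto 2 with lin] | lin]
      | (fun x => ?f (@?g x)) =>
          apply: (@lin_comp _ _ _ _ f g); [solve [auto 2 with lin] | lin]
      | _ => solve [auto 2 with lin]
      end
    end
  end.

Section Tensor.
Variable k : fieldType.
Implicit Types (V W U X : lmodType k).

Lemma eq_sw V W U (t : tensor V W) (f g : V -> W -> U) :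
  (forall x y, f x y = g x y) -> sw t f = sw t g.
Proof. by move=> h; apply: eq_bigr. Qed.

Lemma sw_pure V W U (f : V -> W -> U) v w :
  bilinear_map f -> sw (v ⊗ w) f = f v w.
Proof. by move=> hf; apply: (sum_legs_pure v w (bil_balanced hf)). Qed.

Lemma sw_add V W U (t : tensor V W) (f g : V -> W -> U) :
  sw t f + sw t g = \sw_(x, y <- t) (f x y + g x y).
Proof. by rewrite /sw big_split. Qed.

Lemma sw_sum V W U (t : tensor V W) (I : Type) (s : seq I)
    (F : V -> W -> I -> U) :
  \sw_(x, y <- t) \sum_(i <- s) F x y i = \sum_(i <- s) \sw_(x, y <- t) F x y i.
Proof. exact: exchange_big. Qed.

Lemma sw_id V W (t : tensor V W) : \sw_(x, y <- t) x ⊗ y = t.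
Proof. exact: sum_legs_bpure. Qed.

Lemma lin_sumE V U (f : V -> U) (I : Type) (s : seq I) (F : I -> V) :
  linear f -> f (\sum_(i <- s) F i) = \sum_(i <- s) f (F i).
Proof.
move=> hf; elim: s => [|i s ih]; first by rewrite !big_nil (linear_at0 hf).
by rewrite !big_cons -{1}[F i]scale1r hf scale1r ih.
Qed.

Lemma lin_swE U X V W (f : U -> X) (t : tensor V W) (F : V -> W -> U) :
  linear f -> f (sw t F) = \sw_(x, y <- t) f (F x y).
Proof. by move=> hf; apply: lin_sumE. Qed.

Arguments lin_swE {U X V W} f t F.

Lemma eq_lin V U (f g : V -> U) : (forall v, f v = g v) -> linear g -> linear f.
Proof. by move=> h hg c u v; rewrite !h hg. Qed.

Lemma linZ V U (f : V -> U) c v : linear f -> f (c *: v) = c *: f v.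
Proof. by move=> hf; rewrite -[c *: v]addr0 hf (linear_at0 hf) addr0. Qed.

Lemma linN V U (f : V -> U) v : linear f -> f (- v) = - f v.
Proof. by move=> hf; rewrite -scaleN1r (linZ _ _ hf) scaleN1r. Qed.

Lemma linD V U (f : V -> U) v w : linear f -> f (v + w) = f v + f w.
Proof. by move=> hf; rewrite -{1}[v]scale1r hf scale1r. Qed.

Lemma linB V U (f : V -> U) v w : linear f -> f (v - w) = f v - f w.
Proof. by move=> hf; rewrite addrC -scaleN1r hf scaleN1r addrC. Qed.

Lemma sw_sw V W V' W' U (t : tensor V W) (F : V -> W -> tensor V' W')
    (f : V' -> W' -> U) :
  bilinear_map f -> sw (sw t F) f = \sw_(x, y <- t) sw (F x y) f.
Proof. by move=> hf; apply: (lin_swE _ t F (lin_sw hf)). Qed.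

Lemma exchange_sw V W V' W' U (t : tensor V W) (t' : tensor V' W')
    (F : V -> W -> V' -> W' -> U) :
  \sw_(x, y <- t) \sw_(a, b <- t') F x y a b =
  \sw_(a, b <- t') \sw_(x, y <- t) F x y a b.
Proof. exact: exchange_big. Qed.

Lemma tensor_ext V W U (f g : tensor V W -> U) : linear f -> linear g ->
  (forall v w, f (v ⊗ w) = g (v ⊗ w)) -> forall t, f t = g t.
Proof.
move=> hf hg h t; rewrite -[t]sw_id (lin_swE _ _ _ hf) (lin_swE _ _ _ hg).
by apply: eq_sw.
Qed.

Lemma sw_tensor_mul (A B : algType k) (U : lmodType k) (s t : tensor A B)
    (F : A -> B -> U) : bilinear_map F ->
  sw (tensor_mul s t) F =
  \sw_(a, b <- s) \sw_(a', b' <- t) F (a * a') (b * b').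
Proof.
move=> hF; rewrite (_ : tensor_mul s t =
  \sw_(a, b <- s) \sw_(a', b' <- t) (a * a') ⊗ (b * b')) // sw_sw //.
apply: eq_sw => a b; rewrite sw_sw //; apply: eq_sw => a' b'.
by rewrite sw_pure.
Qed.

End Tensor.
Arguments lin_swE {k U X V W} f t F.

Section LiftAlong.
Variable k : fieldType.
Implicit Types (U V : lmodType k).

Lemma lift_alongP U (X : Type) (i : U -> X) v :
  (exists u, i u = v) -> i (lift_along i v) = v.
Proof. by move=> h; have := xgetPex 0 h. Qed.

Lemma lift_alongE U (X : Type) (i : U -> X) v u :
  injective i -> i u = v -> lift_along i v = u.
Proof. by move=> hi hu; apply: hi; rewrite lift_alongP //; exists u. Qed.

Lemma val_lift (V : lmodType k) (S : submodClosed V) v :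
  v \in S -> val (lift_along (val : subv S -> V) v) = v.
Proof. by move=> h; apply: lift_alongP; exists (Subv h). Qed.

End LiftAlong.

(** * The antipode and its inverse *)

Definition trilinear_map (k : fieldType) (V W X U : lmodType k)
    (F : V -> W -> X -> U) : Prop :=
  [/\ forall b c, linear (fun a => F a b c),
      forall a c, linear (fun b => F a b c) & forall a b, linear (F a b)].

Ltac trilin := split; intros; lin.

Section Coassociativity.
Variable k : fieldType.

(** Coassociativity, in any of its forms (coalgebra, left or right comodule,
    bicomodule), is an equality of triple tensors; every trilinear map then takes
    the same value on the two sides. *)
Lemma sw_reassoc (V W V1 W' W1 U : lmodType k)
    (t : tensor V W) (D : V -> tensor V1 W1)
    (t' : tensor V1 W') (E : W' -> tensor W1 W)
    (F : V1 -> W1 -> W -> U) :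
  \sw_(x, y <- t) \sw_(a, b <- D x) a ⊗ b ⊗ y =
  \sw_(x, y <- t') \sw_(a, b <- E y) x ⊗ a ⊗ b ->
  trilinear_map F ->
  \sw_(x, y <- t) \sw_(a, b <- D x) F a b y =
  \sw_(x, y <- t') \sw_(a, b <- E y) F x a b.
Proof.
move=> h [h1 h2 h3].
pose G (ab : tensor V1 W1) (y : W) := \sw_(a, b <- ab) F a b y.
have bF y : bilinear_map (fun a b => F a b y).
  by split=> [a | b]; [exact: h2 | exact: h1].
have bG : bilinear_map G.
  split=> [ab|y]; last exact: lin_sw.
  by apply: lin_sw_body => a b; exact: h3.
move/(congr1 (fun T => sw T G)): h.
rewrite !sw_sw //.
under eq_sw => x y do rewrite sw_sw //.
under [RHS]eq_sw => x y do rewrite sw_sw //.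
move=> h; transitivity
  (\sw_(x, y <- t) \sw_(a, b <- D x) sw (a ⊗ b ⊗ y) G).
  by do 2 apply: eq_sw => ? ?; rewrite sw_pure // /G sw_pure.
by rewrite h; do 2 apply: eq_sw => ? ?; rewrite sw_pure // /G sw_pure.
Qed.

End Coassociativity.

Section Hopf.
Variables (k : fieldType) (H : algType k) (hH : hopf H).
Local Notation Δ := (comul hH).
Local Notation S := (antipode hH).
Local Notation ε := (counit hH).
Implicit Types (U : lmodType k) (h g : H).

Lemma comul_assoc U (F : H -> H -> H -> U) h : trilinear_map F ->
  \sw_(x, y <- Δ h) \sw_(a, b <- Δ x) F a b y =
  \sw_(x, y <- Δ h) \sw_(a, b <- Δ y) F x a b.
Proof. exact: (sw_reassoc (t := Δ h) (D := Δ) (t' := Δ h) (E := Δ) (comulA hH h)). Qed.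

Lemma comul_counitl U (f : H -> U) h : linear f ->
  \sw_(x, y <- Δ h) ε x *: f y = f h.
Proof.
move=> hf; rewrite -{2}[h](counitl hH) (lin_sumE _ _ hf).
by apply: eq_bigr => p _; rewrite linZ.
Qed.
Arguments comul_counitl {U} f h.

Lemma comul_counitr U (f : H -> U) h : linear f ->
  \sw_(x, y <- Δ h) ε y *: f x = f h.
Proof.
move=> hf; rewrite -{2}[h](counitr hH) (lin_sumE _ _ hf).
by apply: eq_bigr => p _; rewrite linZ.
Qed.
Arguments comul_counitr {U} f h.

Lemma sw_antipodel U (f : H -> U) h : linear f ->
  \sw_(x, y <- Δ h) f (S x * y) = ε h *: f 1.
Proof.
by move=> hf; rewrite -[LHS](lin_sumE _ (fun p => S p.1 * p.2) hf) antipodel linZ.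
Qed.
Arguments sw_antipodel {U} f h.

Lemma sw_antipoder U (f : H -> U) h : linear f ->
  \sw_(x, y <- Δ h) f (x * S y) = ε h *: f 1.
Proof.
by move=> hf; rewrite -[LHS](lin_sumE _ (fun p => p.1 * S p.2) hf) antipoder linZ.
Qed.
Arguments sw_antipoder {U} f h.

Lemma sw_comulM U (F : H -> H -> U) h g : bilinear_map F ->
  sw (Δ (h * g)) F = \sw_(a, b <- Δ h) \sw_(a', b' <- Δ g) F (a * a') (b * b').
Proof. by move=> hF; rewrite comulM sw_tensor_mul. Qed.

Lemma antipode1 : S 1 = 1.
Proof.
have := antipodel hH 1; rewrite counit1 scale1r => h.
rewrite -{2}h -[RHS]/(\sw_(x, y <- Δ 1) S x * y) comul1 sw_pure ?mulr1 //.
by lin.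
Qed.

(** S(g) S(h) and S(hg) are both inverse to the product under convolution on
    H ⊗ H; both equal S(h_1 g_1) h_2 g_2 S(g_3) S(h_3). *)
Lemma antipodeM h g : S (h * g) = S g * S h.
Proof.
have inner y y' : \sw_(a, b <- Δ y) \sw_(a', b' <- Δ y') a * a' * (S b' * S b)
    = ε y *: (ε y' *: 1).
  rewrite -(sw_antipoder (fun v => ε y' *: v)); last by lin.
  apply: eq_sw => a b.
  transitivity (\sw_(a', b' <- Δ y') a * (a' * S b') * S b).
    by apply: eq_sw => a' b'; rewrite !mulrA.
  by rewrite (sw_antipoder (fun v => a * v * S b)) ?mulr1 //; lin.
transitivity (\sw_(x, y <- Δ h) \sw_(x', y' <- Δ g) S (x * x') *
    \sw_(a, b <- Δ y) \sw_(a', b' <- Δ y') a * a' * (S b' * S b)).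
  rewrite -[LHS](comul_counitr (fun v => S (v * g))); last by lin.
  apply: eq_sw => x y.
  rewrite -[S (x * g)](comul_counitr (fun v => S (x * v))); last by lin.
  rewrite (lin_swE (fun v => ε y *: v)); last by lin.
  apply: eq_sw => x' y'.
  by rewrite inner -!scalerAr mulr1.
transitivity (\sw_(x, y <- Δ h) \sw_(a, b <- Δ y) \sw_(x', y' <- Δ g)
    \sw_(a', b' <- Δ y') S (x * x') * (a * a' * (S b' * S b))).
  apply: eq_sw => x y; rewrite exchange_sw; apply: eq_sw => x' y'.
  rewrite (lin_swE (fun v => S (x * x') * v)); last by lin.
  by apply: eq_sw => a b; rewrite (lin_swE (fun v => S (x * x') * v)) //; lin.
rewrite -comul_assoc; last by trilin.
transitivity (\sw_(u, b <- Δ h) \sw_(u', b' <- Δ g) (ε u * ε u') *: (S b' * S b)).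
  apply: eq_sw => u b.
  under eq_sw => x a do (rewrite -comul_assoc; last by trilin).
  rewrite exchange_sw; apply: eq_sw => u' b'.
  rewrite -counitM -[S b' * S b as X in _ = _ *: X]mul1r.
  rewrite -(sw_antipodel (fun v => v * (S b' * S b))); last by lin.
  rewrite sw_comulM; last by lin.
  by do 2 (apply: eq_sw => ? ?); rewrite !mulrA.
under eq_sw => u b do under eq_sw => u' b' do rewrite -scalerA.
rewrite exchange_sw.
rewrite -[S g](comul_counitl S); last by lin.
rewrite (lin_swE (fun v => v * S h)); last by lin.
apply: eq_sw => u' b'.
rewrite (comul_counitl (fun b => ε u' *: (S b' * S b))); last by lin.
by rewrite scalerAl.
Qed.

Lemma counit_antipode h : ε (S h) = ε h.
Proof.
transitivity (\sw_(x, y <- Δ h) (ε (S x * y) : k^o)); last first.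
  by rewrite (sw_antipodel (fun v => ε v : k^o)) ?counit1; [exact: mulr1 | lin].
rewrite -[S h](comul_counitr S); last by lin.
rewrite (lin_swE (fun v => ε v : k^o)); last by lin.
apply: (eq_sw (U := k^o)) => x y.
by rewrite (linZ _ _ (lin_counit hH)) counitM mulrC.
Qed.

(** Dually, Δ ∘ S and S(h_2) ⊗ S(h_1) are both convolution inverse to Δ; both
    equal S(h_1)_1 h_2 S(h_5) ⊗ S(h_1)_2 h_3 S(h_4). *)
Lemma antipode_comul U (F : H -> H -> U) h : bilinear_map F ->
  sw (Δ (S h)) F = \sw_(x, y <- Δ h) F (S y) (S x).
Proof.
move=> hF.
have Fl v : linear (F^~ v) by case: hF.
have Fr v : linear (F v) by case: hF.
have inner p q r : \sw_(y, r' <- Δ r) \sw_(z, s <- Δ r') \sw_(z', y' <- Δ s)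
    F (p * (y * S y')) (q * (z * S z')) = ε r *: F p q.
  rewrite -[p in RHS]mulr1.
  rewrite -(sw_antipoder (fun v => F (p * v) q)); last by lin.
  apply: eq_sw => y r'.
  rewrite -comul_assoc; last by trilin.
  rewrite -[RHS](comul_counitl (fun v => F (p * (y * S v)) q)); last by lin.
  apply: eq_sw => c y'.
  by rewrite (sw_antipoder (fun v => F (p * (y * S y')) (q * v))) ?mulr1 //; lin.
transitivity (\sw_(x, r <- Δ h) \sw_(p, q <- Δ (S x))
  \sw_(y, r' <- Δ r) \sw_(z, s <- Δ r') \sw_(z', y' <- Δ s)
    F (p * (y * S y')) (q * (z * S z'))).
  rewrite -[LHS](comul_counitr (fun v => sw (Δ (S v)) F)); last by lin.
  apply: eq_sw => x r; rewrite (lin_swE (fun v => ε r *: v)); last by lin.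
  by apply: eq_sw => p q; rewrite inner.
transitivity (\sw_(c, s <- Δ h) \sw_(x, w <- Δ c) \sw_(y, z <- Δ w)
  \sw_(z', y' <- Δ s) \sw_(p, q <- Δ (S x))
    F (p * (y * S y')) (q * (z * S z'))).
  rewrite comul_assoc; last by trilin.
  apply: eq_sw => x r; rewrite exchange_sw.
  rewrite comul_assoc; last by trilin.
  apply: eq_sw => y r'; rewrite exchange_sw.
  by apply: eq_sw => z s; rewrite exchange_sw.
rewrite -[RHS](comul_counitl (fun v => \sw_(z', y' <- Δ v) F (S y') (S z')));
  last by lin.
apply: eq_sw => c s.
under eq_sw => x w do rewrite exchange_sw.
rewrite exchange_sw (lin_swE (fun v => ε c *: v)); last by lin.
apply: eq_sw => z' y'.
rewrite -[S y' in RHS]mul1r -[S z' in RHS]mul1r.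
have bM : bilinear_map (fun a b => F (a * S y') (b * S z')) by lin.
rewrite -(sw_pure 1 1 bM) -(comul1 hH).
rewrite -(sw_antipodel (fun v => sw (Δ v) (fun a b => F (a * S y') (b * S z'))));
  last by lin.
apply: eq_sw => x w; rewrite sw_comulM // exchange_sw.
by do 2 apply: eq_sw => ? ?; rewrite !mulrA.
Qed.

Section Sinv.
Variables (Sinv : H -> H).
Hypotheses (SK : cancel S Sinv) (SinvK : cancel Sinv S).

Lemma lin_Sinv : linear Sinv.
Proof. by move=> c u v; apply: (can_inj SK); rewrite antipode_linear !SinvK. Qed.

Lemma Sinv1 : Sinv 1 = 1.
Proof. by rewrite -[X in Sinv X]antipode1 SK. Qed.

Lemma sw_Sinvl U (f : H -> U) h : linear f ->
  \sw_(x, y <- Δ h) f (Sinv y * x) = ε h *: f 1.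
Proof.
move=> hf; rewrite -Sinv1.
rewrite -(sw_antipodel (fun v => f (Sinv v)) h (lin_comp hf lin_Sinv)).
by apply: eq_sw => x y; rewrite -{2}[y]SinvK -antipodeM SK.
Qed.

End Sinv.
End Hopf.
Arguments sw_Sinvl {k H} hH {Sinv} SK SinvK {U} f h.
Arguments comul_counitl {k H} hH {U} f h.
Arguments comul_counitr {k H} hH {U} f h.
Arguments sw_antipodel {k H} hH {U} f h.
Arguments sw_antipoder {k H} hH {U} f h.

(** * Comodules and left coinvariant forms *)

Lemma lin_coact (k : fieldType) (H : algType k) (hH : hopf H) (A : algType k)
  (cA : comodule_algebra hH A) : linear (coact cA).
Proof. exact: rcoact_linear (coact_rcomodule cA). Qed.

#[global] Hint Extern 0 (GRing.linear_for _ (coact _)) => exact: lin_coact : lin.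

Lemma subspaceP (k : fieldType) (V : lmodType k) (P : V -> Prop) (P0 : P 0)
    (Plin : forall (c : k) u v, P u -> P v -> P (c *: u + v)) v :
  reflect (P v) (v \in subspace_of P0 Plin).
Proof. exact: asboolP. Qed.

Section Comodule.
Variables (k : fieldType) (H : algType k) (hH : hopf H).
Local Notation Δ := (comul hH).
Local Notation ε := (counit hH).
Implicit Types (V U : lmodType k) (A : algType k).

Lemma rcoact_assoc V (δ : V -> tensor V H) (hδ : is_rcomodule hH δ)
    U (F : V -> H -> H -> U) v : trilinear_map F ->
  \sw_(x, y <- δ v) \sw_(a, b <- δ x) F a b y =
  \sw_(x, y <- δ v) \sw_(a, b <- Δ y) F x a b.
Proof. exact: (sw_reassoc (t := δ v) (D := δ) (t' := δ v) (E := Δ) (rcoactA hδ v)). Qed.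

Lemma lcoact_assoc V (δ : V -> tensor H V) (hδ : is_lcomodule hH δ)
    U (F : H -> H -> V -> U) v : trilinear_map F ->
  \sw_(x, y <- δ v) \sw_(a, b <- Δ x) F a b y =
  \sw_(x, y <- δ v) \sw_(a, b <- δ y) F x a b.
Proof. exact: (sw_reassoc (t := δ v) (D := Δ) (t' := δ v) (E := δ) (lcoactA hδ v)). Qed.

Lemma sw_rcounit V (δ : V -> tensor V H) (hδ : is_rcomodule hH δ)
    U (f : V -> U) v : linear f -> \sw_(x, y <- δ v) ε y *: f x = f v.
Proof.
move=> hf; rewrite -{2}[v](rcoact_counit hδ) (lin_sumE _ _ hf).
by apply: eq_bigr => p _; rewrite linZ.
Qed.

Lemma sw_lcounit V (δ : V -> tensor H V) (hδ : is_lcomodule hH δ)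
    U (f : V -> U) v : linear f -> \sw_(x, y <- δ v) ε x *: f y = f v.
Proof.
move=> hf; rewrite -{2}[v](lcoact_counit hδ) (lin_sumE _ _ hf).
by apply: eq_bigr => p _; rewrite linZ.
Qed.

Lemma sw_coactM A (cA : comodule_algebra hH A) U (F : A -> H -> U) a b :
  bilinear_map F ->
  sw (coact cA (a * b)) F =
  \sw_(x, y <- coact cA a) \sw_(x', y' <- coact cA b) F (x * x') (y * y').
Proof. by move=> hF; rewrite coactM sw_tensor_mul. Qed.

End Comodule.
Arguments sw_rcounit {k H hH V δ} hδ {U} f v.
Arguments sw_lcounit {k H hH V δ} hδ {U} f v.

Section RightCovariant.
Variables (k : fieldType) (H : algType k) (hH : hopf H).
Variables (A : algType k) (cA : comodule_algebra hH A).
Variables (M : Bimodule A) (δ : M -> tensor M H).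
Hypothesis hM : is_rcovariant_bimodule cA δ.
Local Notation δA := (coact cA).

Let hbim := rcov_bimodule hM.
Let bl : bilinear_map (@lact k A M) := lact_bilinear hbim.
Let br : bilinear_map (@ract k A M) := ract_bilinear hbim.

Lemma sw_rcoact_lact (U : lmodType k) (F : M -> H -> U) a m : bilinear_map F ->
  sw (δ (lact a m)) F =
  \sw_(x, y <- δA a) \sw_(v, z <- δ m) F (lact x v) (y * z).
Proof.
move=> hF; rewrite -[lact a m](ract1 hbim) (rcov_compat hM).
rewrite -[X in sw X]/(\sw_(x, y <- δA a) \sw_(v, z <- δ m)
  \sw_(x', y' <- δA 1) ract (lact x v) x' ⊗ (y * z * y')).
rewrite sw_sw //; apply: eq_sw => x y; rewrite sw_sw //; apply: eq_sw => v z.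
rewrite coact1 sw_pure; last by lin.
by rewrite sw_pure // mulr1 (ract1 hbim).
Qed.

Lemma sw_rcoact_ract (U : lmodType k) (F : M -> H -> U) m b : bilinear_map F ->
  sw (δ (ract m b)) F =
  \sw_(v, z <- δ m) \sw_(x, y <- δA b) F (ract v x) (z * y).
Proof.
move=> hF; rewrite -[m in LHS](lact1 hbim) (rcov_compat hM).
rewrite -[X in sw X]/(\sw_(x, y <- δA 1) \sw_(v, z <- δ m)
  \sw_(x', y' <- δA b) ract (lact x v) x' ⊗ (y * z * y')).
rewrite coact1 sw_pure; last by lin.
rewrite sw_sw //; apply: eq_sw => v z; rewrite sw_sw //; apply: eq_sw => x y.
by rewrite sw_pure // mul1r (lact1 hbim).
Qed.

End RightCovariant.

Section Bicovariant.
Variables (k : fieldType) (H : algType k) (hH : hopf H).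
Variables (G : BiFODC H) (hG : is_bifodc hH G).
Local Notation Δ := (comul hH).
Local Notation S := (antipode hH).
Local Notation ε := (counit hH).
Local Notation δL := (@form_lcoact k H G).
Local Notation δR := (@form_rcoact k H H G).
Local Notation Λ := (subv (left_coinvariants hG)).
Implicit Types (U : lmodType k) (w : G) (h g : H) (θ : Λ).

Let hcov := rfodc_rcov (bifodc_rfodc hG).
Let hbim := rcov_bimodule hcov.
Let bl : bilinear_map (@lact k H G) := lact_bilinear hbim.
Let br : bilinear_map (@ract k H G) := ract_bilinear hbim.
Let dl : linear (diff G) := diff_linear (bifodc_rfodc hG).
Let Ll : linear δL := lcoact_linear (form_lcomodule hG).
Let Rl : linear δR := rcoact_linear (rcov_comodule hcov).

Let dL h : δL (diff G h) = \sw_(x, y <- Δ h) x ⊗ diff G y :=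
  diff_lcolinear hG h.
Let dR h : δR (diff G h) = \sw_(x, y <- Δ h) diff G x ⊗ y :=
  diff_rcolinear (bifodc_rfodc hG) h.

Lemma sw_lcoact_lact U (F : H -> G -> U) a w : bilinear_map F ->
  sw (δL (lact a w)) F =
  \sw_(x, y <- Δ a) \sw_(z, v <- δL w) F (x * z) (lact y v).
Proof.
move=> hF.
have := form_lcompat hG a w 1; rewrite (ract1 hbim) => ->.
rewrite -[X in sw X]/(\sw_(x, y <- Δ a) \sw_(z, v <- δL w)
  \sw_(x', y' <- Δ 1) (x * z * x') ⊗ ract (lact y v) y').
rewrite sw_sw //; apply: eq_sw => x y; rewrite sw_sw //; apply: eq_sw => z v.
rewrite (comul1 hH) sw_pure; last by lin.
by rewrite sw_pure // mulr1 (ract1 hbim).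
Qed.

Lemma sw_lcoact_ract U (F : H -> G -> U) w b : bilinear_map F ->
  sw (δL (ract w b)) F =
  \sw_(z, v <- δL w) \sw_(x, y <- Δ b) F (z * x) (ract v y).
Proof.
move=> hF.
have := form_lcompat hG 1 w b; rewrite (lact1 hbim) => ->.
rewrite -[X in sw X]/(\sw_(x, y <- Δ 1) \sw_(z, v <- δL w)
  \sw_(x', y' <- Δ b) (x * z * x') ⊗ ract (lact y v) y').
rewrite (comul1 hH) sw_pure; last by lin.
rewrite sw_sw //; apply: eq_sw => x y; rewrite sw_sw //; apply: eq_sw => z v.
by rewrite sw_pure // mul1r (lact1 hbim).
Qed.

(** The projection of a Hopf bimodule onto its left coinvariants, along the
    augmentation ideal acting from the left; see [coinv_proj_val] and
    [coinv_proj_lact]. *)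
Definition to_coinv w : G := \sw_(x, v <- δL w) lact (S x) v.

Lemma lin_to_coinv : linear to_coinv.
Proof. by rewrite /to_coinv; lin. Qed.

(** The coaction of S(w_{-2}) w_{-1} ⊗ S(w_{-3}) w_0 collapses by the antipode
    axiom because S reverses the coproduct. *)
Lemma to_coinv_coinv w : to_coinv w \in left_coinvariants hG.
Proof.
apply/subspaceP; rewrite /is_coinv /to_coinv (lin_swE δL) //.
transitivity (\sw_(x, v <- δL w) \sw_(y, u <- δL v) \sw_(z, t <- δL u)
    (S y * z) ⊗ lact (S x) t).
  rewrite -(lcoact_assoc (form_lcomodule hG)); last by trilin.
  apply: eq_sw => x v; rewrite -[LHS]sw_id sw_lcoact_lact; last by lin.
  by rewrite antipode_comul //; lin.
rewrite (lin_swE (pure 1)); last by lin.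
apply: eq_sw => x v.
rewrite -(lcoact_assoc (form_lcomodule hG)); last by trilin.
rewrite -[RHS](sw_lcounit (form_lcomodule hG) (fun v => 1 ⊗ lact (S x) v));
  last by lin.
apply: eq_sw => y u.
by rewrite (sw_antipodel hH (fun a => a ⊗ lact (S x) u)) //; lin.
Qed.

Definition coinv_proj w : Λ := Subv (to_coinv_coinv w).

Lemma lin_coinv_proj : linear coinv_proj.
Proof.
by move=> c u v; apply: val_inj; rewrite (lin_val (S := left_coinvariants hG)) /=
  lin_to_coinv.
Qed.

Lemma coinvP θ : δL (val θ) = 1 ⊗ val θ.
Proof. by have /subspaceP := valP θ. Qed.

Lemma coinv_proj_val θ : coinv_proj (val θ) = θ.
Proof.
apply: val_inj; rewrite /= /to_coinv coinvP sw_pure; last by lin.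
by rewrite antipode1 (lact1 hbim).
Qed.

Lemma coinv_proj_lact a w : coinv_proj (lact a w) = ε a *: coinv_proj w.
Proof.
apply: val_inj; rewrite (linZ _ _ (lin_val (S := left_coinvariants hG))) /=.
rewrite /to_coinv sw_lcoact_lact; last by lin.
rewrite exchange_sw (lin_swE (fun v => ε a *: v)); last by lin.
apply: eq_sw => z v.
rewrite -[v in RHS](lact1 hbim).
rewrite -(sw_antipodel hH (fun b => lact (S z) (lact b v))) //; last by lin.
by apply: eq_sw => x y; rewrite antipodeM !(lactM hbim).
Qed.

(** P(P(w) g) = P(S(w_{-1}) w_0 g) = ε(S(w_{-1})) P(w_0 g) = P(w g). This is what
    makes w |-> P(w g) an action on coinvariant forms. *)
Lemma coinv_proj_ract w g :
  coinv_proj (ract (val (coinv_proj w)) g) = coinv_proj (ract w g).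
Proof.
rewrite /= /to_coinv.
have cl := lin_coinv_proj.
rewrite (lin_swE (fun v => coinv_proj (ract v g))); last by lin.
rewrite -[RHS](sw_lcounit (form_lcomodule hG) (fun v => coinv_proj (ract v g)));
  last by lin.
by apply: eq_sw => x v; rewrite (lract hbim) coinv_proj_lact counit_antipode.
Qed.

Lemma maurer_cartanE h : maurer_cartan hG h = coinv_proj (diff G h).
Proof.
apply: lift_alongE; first exact: val_inj.
rewrite /= /to_coinv dL.
rewrite sw_sw; last by lin.
rewrite -[RHS]/(\sw_(x, y <- Δ h) lact (S x) (diff G y)).
by apply: eq_sw => x y; rewrite sw_pure //; lin.
Qed.

Lemma coinv_ractE θ h : coinv_ract θ h = coinv_proj (ract (val θ) h).
Proof.
apply: lift_alongE; first exact: val_inj.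
rewrite /= /to_coinv sw_lcoact_ract; last by lin.
rewrite coinvP sw_pure; last by lin.
rewrite -[RHS]/(\sw_(x, y <- Δ h) ract (lact (S x) (val θ)) y).
by apply: eq_sw => x y; rewrite mul1r (lract hbim).
Qed.

Lemma bil_coinv_ract : bilinear_map (@coinv_ract k H hH G hG).
Proof.
have cl := lin_coinv_proj.
split=> [θ|h].
  by apply: (eq_lin (coinv_ractE θ)); lin.
by apply: (eq_lin (fun θ => coinv_ractE θ h)); lin.
Qed.

Lemma lin_maurer_cartan : linear (maurer_cartan hG).
Proof. by apply: (eq_lin maurer_cartanE); have cl := lin_coinv_proj; lin. Qed.

Lemma coinv_ractM θ h g : coinv_ract θ (h * g) = coinv_ract (coinv_ract θ h) g.
Proof. by rewrite !coinv_ractE coinv_proj_ract (ractM hbim). Qed.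

Lemma coinv_ract1 θ : coinv_ract θ 1 = θ.
Proof. by rewrite coinv_ractE (ract1 hbim) coinv_proj_val. Qed.

(** Apply P to d(hg) = dh g + h dg. *)
Lemma maurer_cartanM h g :
  maurer_cartan hG (h * g) =
  coinv_ract (maurer_cartan hG h) g + ε h *: maurer_cartan hG g.
Proof.
rewrite coinv_ractE !maurer_cartanE coinv_proj_ract.
by rewrite (diff_leibniz (bifodc_rfodc hG)) (linD _ _ lin_coinv_proj) coinv_proj_lact.
Qed.

(** P fixes θ = sum a db and sends it to sum ε(a) ϖ(b). *)
Lemma maurer_cartan_surj θ : exists h, θ = maurer_cartan hG h.
Proof.
have [s hs] := diff_span (bifodc_rfodc hG) (val θ).
exists (\sum_(p <- s) ε p.1 *: p.2).
rewrite -[LHS]coinv_proj_val hs (lin_sumE _ _ lin_coinv_proj).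
rewrite (lin_sumE _ _ lin_maurer_cartan); apply: eq_bigr => p _.
by rewrite coinv_proj_lact -maurer_cartanE (linZ _ _ lin_maurer_cartan).
Qed.

(** Coinvariant forms are a right subcomodule: by the bicomodule axiom P ⊗ id
    fixes the right coaction of θ, and P takes values in coinvariants. *)
Lemma coinv_rcoactP θ : \sw_(x, y <- coinv_rcoact θ) val x ⊗ y = δR (val θ).
Proof.
have cl := lin_coinv_proj.
apply: (lift_alongP (i := fun t : tensor Λ H => \sw_(x, y <- t) val x ⊗ y : tensor G H)).
exists (\sw_(w, c <- δR (val θ)) coinv_proj w ⊗ c).
rewrite sw_sw; last by lin.
transitivity (\sw_(w, c <- δR (val θ)) \sw_(x, v <- δL w) lact (S x) v ⊗ c).
  apply: eq_sw => w c; rewrite sw_pure; last by lin.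
  by rewrite /= /to_coinv (lin_swE (fun v => v ⊗ c)) //; lin.
rewrite (sw_reassoc (form_bicomodule hG (val θ))); last by trilin.
rewrite coinvP sw_pure; last by lin.
rewrite -[RHS]sw_id; apply: eq_sw => w c.
by rewrite antipode1 (lact1 hbim).
Qed.

Lemma sw_coinv_rcoact U (F : Λ -> H -> U) θ : bilinear_map F ->
  sw (coinv_rcoact θ) F = \sw_(w, c <- δR (val θ)) F (coinv_proj w) c.
Proof.
move=> hF; have cl := lin_coinv_proj.
rewrite -coinv_rcoactP sw_sw; last by lin.
by apply: eq_sw => x y; rewrite sw_pure ?coinv_proj_val //; lin.
Qed.

Lemma lin_coinv_rcoact : linear (@coinv_rcoact k H hH G hG).
Proof.
have cl := lin_coinv_proj.
apply: (eq_lin (g := fun θ => \sw_(w, c <- δR (val θ)) coinv_proj w ⊗ c)).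
  by move=> θ; rewrite -[LHS]sw_id sw_coinv_rcoact //; lin.
by lin.
Qed.

(** The right coaction of ϖ(h) is ϖ(h_2) ⊗ S(h_1) h_3; multiplying by a further
    leg on the left cancels S. This is the identity behind the colinearity of
    the differential of vertical forms. *)
Lemma maurer_cartan_rcolinear U (F : Λ -> H -> U) h : bilinear_map F ->
  \sw_(x, y <- Δ h) \sw_(θ, c <- coinv_rcoact (maurer_cartan hG y)) F θ (x * c) =
  \sw_(x, y <- Δ h) F (maurer_cartan hG x) y.
Proof.
move=> hF; have cl := lin_coinv_proj; have ml := lin_maurer_cartan.
have step y x : \sw_(θ, c <- coinv_rcoact (maurer_cartan hG y)) F θ (x * c) =
    \sw_(a, b <- Δ y) \sw_(b1, b2 <- Δ b) F (maurer_cartan hG b1) (x * (S a * b2)).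
  rewrite sw_coinv_rcoact; last by lin.
  rewrite maurer_cartanE /= /to_coinv dL sw_sw; last by lin.
  rewrite (lin_swE δR) // sw_sw; last by lin.
  apply: eq_sw => a b; rewrite sw_pure; last by lin.
  rewrite (sw_rcoact_lact hcov); last by lin.
  rewrite antipode_comul dR; last by lin.
  rewrite -(comul_counitr hH (fun a => \sw_(b1, b2 <- Δ b)
    F (maurer_cartan hG b1) (x * (S a * b2)))); last by lin.
  apply: eq_sw => a1 a2; rewrite sw_sw; last by lin.
  rewrite (lin_swE (fun v => ε a2 *: v)); last by lin.
  apply: eq_sw => b1 b2; rewrite sw_pure; last by lin.
  by rewrite coinv_proj_lact counit_antipode maurer_cartanE (linZ _ _ (hF.2 _)).
under eq_sw => x y do rewrite step.
rewrite -comul_assoc; last by trilin.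
rewrite -[RHS](comul_counitl hH (fun b => \sw_(b1, b2 <- Δ b) F (maurer_cartan hG b1) b2));
  last by lin.
apply: eq_sw => c b.
rewrite exchange_sw (lin_swE (fun v => ε c *: v)); last by lin.
apply: eq_sw => b1 b2.
rewrite -[b2 in RHS]mul1r.
rewrite -(sw_antipoder hH (fun v => F (maurer_cartan hG b1) (v * b2)));
  last by lin.
by apply: eq_sw => x a; rewrite mulrA.
Qed.

End Bicovariant.

(** * Covariance of a form calculus, checked on differentials *)

(** For a bimodule with a differential whose forms a db span, a coaction that is
    compatible with the left action and the differential is determined, and
    every remaining axiom is an identity of linear maps that holds on a db. *)
Section FormCriterion.
Variables (k : fieldType) (H : algType k) (hH : hopf H).
Variables (A : algType k) (cA : comodule_algebra hH A).
Variable G : RFODC H A.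
Local Notation Δ := (comul hH).
Local Notation ε := (counit hH).
Local Notation δA := (coact cA).
Local Notation δ := (@form_rcoact k H A G).
Local Notation d := (diff G).

Lemma span_ext (U : lmodType k) (f g : G -> U) :
  (forall w : G, exists s : seq (A * A), w = \sum_(p <- s) lact p.1 (d p.2)) ->
  linear f -> linear g -> (forall a b, f (lact a (d b)) = g (lact a (d b))) ->
  forall w, f w = g w.
Proof.
move=> hs hf hg h w; have [s ->] := hs w.
by rewrite !lin_sumE //; apply: eq_bigr => p _.
Qed.

Hypothesis hbim : is_bimodule G.
Hypothesis dl : linear d.
Hypothesis dM : forall a b, d (a * b) = ract (d a) b + lact a (d b).
Hypothesis dspan : forall w : G, exists s : seq (A * A),
    w = \sum_(p <- s) lact p.1 (d p.2).
Hypothesis δl : linear δ.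
Hypothesis δlact : forall a w,
  δ (lact a w) = \sw_(x, y <- δA a) \sw_(v, z <- δ w) lact x v ⊗ (y * z).
Hypothesis δd : forall a, δ (d a) = \sw_(x, y <- δA a) d x ⊗ y.

Let bl : bilinear_map (@lact k A G) := lact_bilinear hbim.
Let br : bilinear_map (@ract k A G) := ract_bilinear hbim.

Lemma sw_rcoact_diff (U : lmodType k) (F : G -> H -> U) a b : bilinear_map F ->
  sw (δ (lact a (d b))) F =
  \sw_(x, y <- δA a) \sw_(u, v <- δA b) F (lact x (d u)) (y * v).
Proof.
move=> hF; rewrite δlact sw_sw //; apply: eq_sw => x y.
rewrite sw_sw // δd sw_sw; last by lin.
by apply: eq_sw => u v; rewrite !sw_pure //; lin.
Qed.

(** On a db the coaction is a_0 db_0 ⊗ a_1 b_1, so the comodule axioms follow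
    from those of A. *)
Lemma rcomodule_of_diff : is_rcomodule hH δ.
Proof.
split=> // w.
- rewrite -[LHS]/(\sw_(p, q <- δ w) \sw_(a, b <- δ p) a ⊗ b ⊗ q).
  rewrite -[RHS]/(\sw_(p, q <- δ w) \sw_(a, b <- Δ q) p ⊗ a ⊗ b).
  move: w; apply: (span_ext dspan); try by lin.
  move=> a b; rewrite !sw_rcoact_diff; try by lin.
  transitivity (\sw_(x, y <- δA a) \sw_(x', y' <- Δ y) \sw_(u, v <- δA b)
    \sw_(u', v' <- Δ v) lact x (d u) ⊗ (x' * u') ⊗ (y' * v')).
    rewrite -(rcoact_assoc (coact_rcomodule cA)); last by trilin.
    apply: eq_sw => x y.
    under [RHS]eq_sw => z t do
      (rewrite -(rcoact_assoc (coact_rcomodule cA)); last by trilin).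
    rewrite exchange_sw; apply: eq_sw => u v.
    by rewrite sw_rcoact_diff //; lin.
  apply: eq_sw => x y; rewrite exchange_sw; apply: eq_sw => u v.
  by rewrite sw_comulM //; lin.
- rewrite -[LHS]/(\sw_(p, q <- δ w) ε q *: p).
  move: w; apply: (span_ext dspan); try by lin.
  move=> a b; rewrite sw_rcoact_diff; last by lin.
  rewrite -[RHS](sw_rcounit (coact_rcomodule cA) (fun x => lact x (d b)));
    last by lin.
  apply: eq_sw => x y.
  rewrite -[d b in RHS](sw_rcounit (coact_rcomodule cA) d) //.
  rewrite (lin_swE (fun v => ε y *: lact x v)); last by lin.
  apply: eq_sw => u v.
  by rewrite counitM -scalerA (linZ _ _ (bl.1 _)).
Qed.

(** Compatibility with the right action follows from that with the left one,
    since (a db) c = a d(bc) - ab dc. *)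
Lemma rcovariant_of_diff : is_rcovariant_bimodule cA δ.
Proof.
split=> //; first exact: rcomodule_of_diff.
move=> a w b.
rewrite -[RHS]/(\sw_(x, y <- δA a) \sw_(v, z <- δ w) \sw_(x', y' <- δA b)
  ract (lact x v) x' ⊗ (y * z * y')).
transitivity (\sw_(x, y <- δA a) \sw_(v, z <- δ (ract w b)) lact x v ⊗ (y * z)).
  by rewrite (lract hbim) δlact.
apply: eq_sw => x y.
move: w; apply: (span_ext dspan); try by lin.
move=> e c; rewrite sw_rcoact_diff; last by lin.
rewrite (lract hbim) (_ : ract (d c) b = d (c * b) - lact c (d b)); last first.
  by rewrite dM addrK.
rewrite (linB _ _ (bl.1 e)) -(lactM hbim).
rewrite (linB (f := fun w => sw (δ w) (fun v z => lact x v ⊗ (y * z))));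
  last by lin.
rewrite !sw_rcoact_diff; try by lin.
rewrite sw_coactM; last by lin.
apply/eqP; rewrite subr_eq; apply/eqP.
rewrite sw_add; apply: eq_sw => p q.
rewrite sw_coactM; last by lin.
rewrite sw_add; apply: eq_sw => u v.
rewrite sw_add; apply: eq_sw => b0 b1.
rewrite dM (linD _ _ (bl.1 p)) (linD _ _ (bl.1 x)) (linD _ _ ((bil_pure _ _).2 _)) !mulrA.
by rewrite -!(lract hbim) -!(lactM hbim) !mulrA.
Qed.

End FormCriterion.

(** * Covariance of a field calculus, checked on functions *)

(** Conditions on the Lie derivative that imply all axioms of a covariant
    calculus of vector fields. Injectivity is assumed with coefficients in an
    arbitrary space W, since the coaction has to be tested in X ⊗ H and its
    coassociativity in X ⊗ (H ⊗ H). *)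
Section FieldCriterion.
Variables (k : fieldType) (H : algType k) (hH : hopf H).
Variables (A : algType k) (cA : comodule_algebra hH A).
Variable X : RFOVC H A.
Local Notation Δ := (comul hH).
Local Notation S := (antipode hH).
Local Notation ε := (counit hH).
Local Notation δA := (coact cA).
Local Notation δ := (@vf_rcoact k H A X).

Hypothesis bl : bilinear_map (@lact k A X).
Hypothesis br : bilinear_map (@ract k A X).
Hypothesis bL : bilinear_map (@lie k H A X).
Hypothesis δl : linear δ.
Hypothesis Ll : forall a (x : X) b, lie (lact a x) b = a * lie x b.
Hypothesis L1 : forall x : X, lie x 1 = 0.
Hypothesis LM : forall (x : X) a b,
  lie x (a * b) = lie x a * b + lie (ract x a) b.
Hypothesis Lδ : forall (x : X) a,
  δA (lie x a) = \sw_(y, h <- δ x) \sw_(b, g <- δA a) lie y b ⊗ (h * g).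
Hypothesis Linj : forall (W : lmodType k) (t : tensor X W),
  (forall a, \sw_(x, w <- t) lie x a ⊗ w = 0) -> t = 0.

Lemma lie_injective : injective (@lie k H A X).
Proof.
move=> x y hxy; apply/eqP; rewrite -subr_eq0; apply/eqP.
pose f (t : tensor X k^o) := \sw_(x, c <- t) c *: x.
have bf : bilinear_map (fun (x : X) (c : k^o) => c *: x).
  split=> z; last by apply: lin_scaler.
  exact: (@lin_scalel _ _ _ (fun c : k^o => c)).
have <- : f ((x - y) ⊗ 1) = x - y by rewrite /f sw_pure // scale1r.
rewrite (Linj (t := (x - y) ⊗ 1)) /f ?(linear_at0 (lin_sw bf)) // => a.
rewrite sw_pure; last by lin.
by rewrite (linB _ _ (bL.2 a)) hxy subrr (linear_at0 ((bil_pure _ _).2 _)).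
Qed.

Lemma lie_ract (x : X) a b : lie (ract x a) b = lie x (a * b) - lie x a * b.
Proof. by rewrite LM addrC addKr. Qed.

Lemma lie_ext (x y : X) : (forall a, lie x a = lie y a) -> x = y.
Proof. by move=> h; apply: lie_injective; apply/boolp.funext. Qed.

(** The Leibniz rule says how x · a acts on functions: by
    b |-> L_x(ab) - L_x(a) b. All bimodule axioms become identities in A. *)
Lemma bimodule_of_lie : is_bimodule X.
Proof.
split=> //.
- by move=> m; apply: lie_ext => a; rewrite Ll mul1r.
- by move=> a b m; apply: lie_ext => c; rewrite !Ll mulrA.
- by move=> m; apply: lie_ext => a; rewrite lie_ract mul1r L1 mul0r subr0.
- move=> a b m; apply: lie_ext => c; rewrite !lie_ract !mulrA.
  by rewrite mulrBl opprB addrA subrK.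
- by move=> a b m; apply: lie_ext => c; rewrite !(lie_ract, Ll) mulrBr !mulrA.
Qed.

(** Colinearity of the Lie derivative does not describe L_{x_0}(a) ⊗ x_1 but
    L_{x_0}(a_0) ⊗ x_1 a_1. The factor a_1 acts through a right H-module structure
    on the coefficients and is removed by the antipode, so this twisted
    evaluation is injective as well. *)
Section Twist.
Variables (W : lmodType k) (r : W -> H -> W).
Hypothesis br' : bilinear_map r.
Hypothesis r1 : forall w, r w 1 = w.
Hypothesis rM : forall w g h, r w (g * h) = r (r w g) h.

Definition twisted_lie (t : tensor X W) (a : A) : tensor A W :=
  \sw_(x, w <- t) \sw_(b, h <- δA a) lie x b ⊗ r w h.

Lemma twisted_lie_inj (t t' : tensor X W) :
  (forall a, twisted_lie t a = twisted_lie t' a) -> t = t'.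
Proof.
have untwist s a : \sw_(x, w <- s) lie x a ⊗ w =
    \sw_(b, h <- δA a) \sw_(c, w <- twisted_lie s b) c ⊗ r w (S h).
  rewrite /twisted_lie.
  transitivity (\sw_(x, w <- s) \sw_(b, h <- δA a) \sw_(c, g <- δA b)
      lie x c ⊗ r (r w g) (S h)); last first.
    rewrite exchange_sw; apply: eq_sw => b h.
    rewrite sw_sw; last by lin.
    apply: eq_sw => x w; rewrite sw_sw; last by lin.
    by apply: eq_sw => c g; rewrite sw_pure //; lin.
  apply: eq_sw => x w.
  rewrite (rcoact_assoc (coact_rcomodule cA)); last by trilin.
  rewrite -[LHS](sw_rcounit (coact_rcomodule cA) (fun b => lie x b ⊗ w));
    last by lin.
  apply: eq_sw => b h; rewrite -[w in LHS]r1.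
  rewrite -(sw_antipoder hH (fun c => lie x b ⊗ r w c)); last by lin.
  by apply: eq_sw => c g; rewrite rM.
move=> h; apply/eqP; rewrite -subr_eq0; apply/eqP; apply: Linj => a.
rewrite (linB (f := fun t => \sw_(x, w <- t) lie x a ⊗ w)); last by lin.
by rewrite !untwist; apply/eqP; rewrite subr_eq0; apply/eqP;
  apply: eq_sw => b c; rewrite h.
Qed.

End Twist.

Local Notation T := (twisted_lie (@GRing.mul H)).

Lemma twisted_lie_coact x a : T (δ x) a = δA (lie x a).
Proof. by rewrite Lδ. Qed.

Lemma twisted_lie_coact_inj (t t' : tensor X H) : (forall a, T t a = T t' a) -> t = t'.
Proof. by apply: twisted_lie_inj; [lin | exact: mulr1 | exact: mulrA]. Qed.

(** The diagonal action of H on H ⊗ H; the one needed to compare both sides of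
    coassociativity. *)
Definition diag_act (w : tensor H H) (c : H) : tensor H H :=
  \sw_(h, g <- w) \sw_(c1, c2 <- Δ c) (h * c1) ⊗ (g * c2).

Lemma bil_diag_act : bilinear_map diag_act.
Proof. by rewrite /diag_act; lin. Qed.

Lemma diag_act1 w : diag_act w 1 = w.
Proof.
rewrite /diag_act -[RHS]sw_id; apply: eq_sw => h g.
by rewrite (comul1 hH) sw_pure ?mulr1 //; lin.
Qed.

Lemma diag_actM w a b : diag_act w (a * b) = diag_act (diag_act w a) b.
Proof.
rewrite /diag_act sw_sw; last by lin.
apply: eq_sw => h g; rewrite sw_sw; last by lin.
rewrite sw_comulM; last by lin.
apply: eq_sw => c1 c2; rewrite sw_pure; last by lin.
by apply: eq_sw => d1 d2; rewrite !mulrA.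
Qed.

Lemma comul_diag_act h c : diag_act (Δ h) c = Δ (h * c).
Proof. by rewrite -[RHS]sw_id sw_comulM //; lin. Qed.

(** The twisted evaluations at a of (δ ⊗ id) δ x and (id ⊗ Δ) δ x are the two
    iterated coactions of L_x(a), which agree. *)
Lemma rcomodule_of_lie : is_rcomodule hH δ.
Proof.
have bd := bil_diag_act.
split=> // x.
- rewrite -[LHS]/(\sw_(p, q <- δ x) \sw_(a, b <- δ p) a ⊗ b ⊗ q).
  rewrite -[RHS]/(\sw_(p, q <- δ x) \sw_(a, b <- Δ q) p ⊗ a ⊗ b).
  (* Move the tensor to X ⊗ (H ⊗ H), where injectivity applies. *)
  pose back (t : tensor X (tensor H H)) := \sw_(y, w <- t) \sw_(h, g <- w) y ⊗ h ⊗ g.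
  have backE y h g : back (y ⊗ (h ⊗ g)) = y ⊗ h ⊗ g.
    by rewrite /back sw_pure ?sw_pure //; lin.
  have backl : linear back by rewrite /back; lin.
  transitivity (back (\sw_(p, q <- δ x) \sw_(a, b <- δ p) a ⊗ (b ⊗ q))).
    rewrite (lin_swE back) //; apply: eq_sw => p q.
    by rewrite (lin_swE back) //; apply: eq_sw => a b.
  transitivity (back (\sw_(p, q <- δ x) p ⊗ Δ q)); last first.
    rewrite (lin_swE back) //; apply: eq_sw => p q.
    by rewrite /back sw_pure //; lin.
  congr back; apply: (twisted_lie_inj bil_diag_act diag_act1 diag_actM) => a.
  rewrite /twisted_lie !sw_sw; try by lin.
  transitivity (\sw_(b, h <- δA (lie x a)) b ⊗ Δ h); last first.
    rewrite Lδ sw_sw; last by lin.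
    apply: eq_sw => p q; rewrite sw_pure; last by lin.
    rewrite sw_sw; last by lin.
    by apply: eq_sw => b h; rewrite sw_pure ?comul_diag_act //; lin.
  transitivity (\sw_(b, h <- δA (lie x a)) \sw_(c, g <- δA b) c ⊗ (g ⊗ h)).
    rewrite Lδ sw_sw; last by lin.
    apply: eq_sw => p q; rewrite !sw_sw; try by lin.
    transitivity (\sw_(b, h <- δA a) \sw_(c, g <- δA (lie p b)) c ⊗ (g ⊗ (q * h)));
      last by apply: eq_sw => b h; rewrite sw_pure //; lin.
    transitivity (\sw_(b, h <- δA a) \sw_(y, v <- δ p) \sw_(c, g <- δA b)
        lie y c ⊗ ((v * g) ⊗ (q * h))).
      rewrite exchange_sw; apply: eq_sw => y v.
      rewrite sw_pure; last by lin.
      rewrite (rcoact_assoc (coact_rcomodule cA)); last by trilin.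
      apply: eq_sw => b h; rewrite /diag_act sw_pure; last by lin.
      by rewrite (lin_swE (pure (lie y b))) //; lin.
    apply: eq_sw => b h; rewrite Lδ sw_sw; last by lin.
    apply: eq_sw => y v; rewrite sw_sw; last by lin.
    by apply: eq_sw => c g; rewrite sw_pure //; lin.
  rewrite (rcoact_assoc (coact_rcomodule cA)); last by trilin.
  apply: eq_sw => b h; rewrite -[Δ h in RHS]sw_id (lin_swE (pure b)) //; lin.
- rewrite -[LHS]/(\sw_(p, q <- δ x) ε q *: p).
  apply: lie_ext => a; rewrite (lin_swE (fun y : X => lie y a)); last by lin.
  rewrite -[lie x a](sw_rcounit (coact_rcomodule cA) (fun b => b)); last by lin.
  rewrite Lδ sw_sw; last by lin.
  apply: eq_sw => p q; rewrite sw_sw; last by lin.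
  rewrite (linZ _ _ (bL.2 a)).
  rewrite -[a in LHS](rcoact_counit (coact_rcomodule cA)).
  rewrite (lin_sumE _ _ (bL.1 p)) scaler_sumr; apply: eq_bigr => h _.
  by rewrite sw_pure ?counitM ?scalerA ?(linZ _ _ (bL.1 p)) ?scalerA //; lin.
Qed.

Lemma rcovariant_of_lie : is_rcovariant_bimodule cA δ.
Proof.
split=> //; [exact: bimodule_of_lie | exact: rcomodule_of_lie |].
move=> a x b.
rewrite -[RHS]/(\sw_(p, q <- δA a) \sw_(y, h <- δ x) \sw_(u, v <- δA b)
  ract (lact p y) u ⊗ (q * h * v)).
apply: twisted_lie_coact_inj => c; rewrite twisted_lie_coact.
rewrite lie_ract !Ll -mulrA -mulrBr -lie_ract -[LHS]sw_id sw_coactM;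
  last by lin.
rewrite /twisted_lie sw_sw; last by lin.
apply: eq_sw => p q.
rewrite lie_ract.
rewrite (linB (f := fun T => \sw_(u, v <- δA T) (p * u) ⊗ (q * v)));
  last by lin.
rewrite sw_coactM; last by lin.
rewrite !Lδ !sw_sw; try by lin.
apply/eqP; rewrite subr_eq; apply/eqP; rewrite sw_add; apply: eq_sw => y h.
rewrite !sw_sw; try by lin.
rewrite sw_coactM; last by lin.
rewrite sw_add; apply: eq_sw => u v.
rewrite !sw_pure; try by lin.
rewrite sw_add; apply: eq_sw => z t.
rewrite sw_pure; last by lin.
rewrite lie_ract !Ll (linB _ _ ((bil_pure _ _).2 _)) !mulrA.
by rewrite subrK.
Qed.

Lemma rfovc_of_lie : is_rfovc cA X.
Proof. by split=> //; [exact: rcovariant_of_lie | exact: lie_injective]. Qed.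

End FieldCriterion.

(** * Quantum tangent spaces *)

(** Finite sums P(v) = sum b(v, w_i) v_i that are idempotent are built so as to
    fix more and more vectors: if u = x - P(x) is not zero, choose w with
    b(u, w) = c not zero and replace P by P + c^{-1} b((1 - P) -, w) u. *)
Lemma dual_basis (k : fieldType) (V W : lmodType k) (b : V -> W -> k^o) :
  finite_dim V -> bilinear_map b -> (forall v, (forall w, b v w = 0) -> v = 0) ->
  exists s : seq (V * W), forall v, v = \sum_(p <- s) (b v p.2 : k) *: p.1.
Proof.
move=> [n [e he]] [bl br] nd.
pose P (s : seq (V * W)) v := \sum_(p <- s) (b v p.2 : k) *: p.1.
have Pl s : linear (P s).
  by apply: lin_sum => p; apply: (@lin_scalel _ _ _ (b^~ p.2)).
have step (s0 : seq V) : exists s, (forall v, P s (P s v) = P s v) /\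
    forall v, v \in s0 -> P s v = v.
  elim: s0 => [|x s0 [s [PP Ps]]].
    by exists [::]; split=> // v; rewrite /P !big_nil.
  pose u := x - P s x.
  have Pu : P s u = 0 by rewrite (linB _ _ (Pl s)) PP subrr.
  have [u0|/boolp.existsNP [w /eqP bw]] := boolp.pselect (forall w, b u w = 0).
    exists s; split=> // v; rewrite inE => /orP[/eqP ->|]; last exact: Ps.
    by apply/esym/eqP; rewrite -subr_eq0; apply/eqP/nd.
  pose c := (b u w : k)^-1.
  pose w' := c *: (w - \sum_(p <- s) (b p.1 w : k) *: p.2).
  have bw' v : b v w' = c * b (v - P s v) w.
    rewrite (linZ _ _ (bl v)) (linB _ _ (bl v)) (linB _ _ (br w)).
    rewrite (lin_sumE _ _ (bl v)) [X in _ = _ * (_ - X)](lin_sumE _ _ (br w)).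
    congr (_ * (_ - _)); apply: eq_bigr => p _.
    by rewrite (linZ _ _ (bl v)) (linZ _ _ (br w)) /GRing.scale /= mulrC.
  have P' v : P ((u, w') :: s) v = (c * b (v - P s v) w) *: u + P s v.
    by rewrite /P big_cons /= bw'.
  have P'P v : P ((u, w') :: s) (P s v) = P s v.
    by rewrite P' PP subrr (linear_at0 (br w)) mulr0 scale0r add0r.
  have P'u : P ((u, w') :: s) u = u.
    by rewrite P' Pu subr0 addr0 mulVf ?scale1r.
  exists ((u, w') :: s); split=> v.
    rewrite [P _ v]P' (linD _ _ (Pl _)) (linZ _ _ (Pl _)) P'u P'P.
    by [].
  rewrite inE => /orP[/eqP ->|/Ps Pv].
    by rewrite P' mulVf // scale1r subrK.
  by rewrite P' Pv subrr (linear_at0 (br w)) mulr0 scale0r add0r.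
have [s [_ Ps]] := step [seq e i | i <- enum 'I_n].
exists s => v; have [c ->] := he v.
rewrite -[RHS]/(P s _) (lin_sumE _ _ (Pl s)); apply: eq_bigr => i _.
by rewrite (linZ _ _ (Pl s)) Ps // map_f ?mem_enum.
Qed.

Lemma lin_finite_dual (k : fieldType) (H : algType k)
  (f : subv (finite_dual H)) : linear (val f : H -> k^o).
Proof. by have /subspaceP [/subspaceP] := valP f. Qed.

Lemma lin_tangent (k : fieldType) (H : algType k) (hH : hopf H)
    (g : submodClosed (H -> k^o)) (hg : is_quantum_tangent_space hH g)
    (χ : subv g) : linear (val χ : H -> k^o).
Proof. by have /(qts_finite_dual hg)/subspaceP [/subspaceP] := valP χ. Qed.

#[global] Hint Extern 0 (GRing.linear_for _ (@isSub.val_subdef _ _ _ _ _)) =>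
  first [ exact: lin_finite_dual
        | match goal with h : is_quantum_tangent_space _ _ |- _ =>
            exact: (lin_tangent h) end ] : lin.

Section TangentSpace.
Variables (k : fieldType) (H : algType k) (hH : hopf H).
Variables (g : submodClosed (H -> k^o)).
Hypotheses (hg : is_quantum_tangent_space hH g) (bg : bicovariant_qts hH g).
Local Notation Δ := (comul hH).
Local Notation S := (antipode hH).
Local Notation ε := (counit hH).
Implicit Types (χ : subv g) (h : H) (U : lmodType k).

Lemma tangent_dual_basis : exists s : seq (subv g * H),
  forall χ, χ = \sum_(p <- s) (val χ p.2 : k) *: p.1.
Proof.
apply: (dual_basis (b := fun χ h => val χ h)); first exact: qts_finite_dim hg.
  by split=> [χ|h]; lin.
by move=> χ h0; apply: val_inj; apply/boolp.funext.
Qed.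

Lemma tangent1 χ : val χ 1 = 0.
Proof. exact: (qts_unit hg (valP χ)). Qed.

(** With a dual basis (χ_i, h_i) of g, a tensor t is the sum over i of
    t(-, h_i) ⊗ χ_i. *)
Lemma eval2_inj : injective (@eval2 k H (finite_dual H) g).
Proof.
have [s hs] := tangent_dual_basis.
have rec (t : tensor (subv (finite_dual H)) (subv g)) :
    t = \sum_(p <- s) (\sw_(f, χ <- t) (val χ p.2 : k) *: f) ⊗ p.1.
  rewrite -[LHS]sw_id.
  transitivity (\sw_(f, χ <- t) \sum_(p <- s) ((val χ p.2 : k) *: f) ⊗ p.1).
    apply: eq_sw => f χ; rewrite [χ in LHS]hs (lin_sumE _ _ ((bil_pure _ _).1 f)).
    apply: eq_bigr => p _.
    by rewrite (linZ _ _ ((bil_pure _ _).1 f)) (linZ _ _ ((bil_pure _ _).2 p.1)).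
  rewrite sw_sum; apply: eq_bigr => p _.
  by rewrite [in RHS](lin_swE (fun f => f ⊗ p.1)) //; lin.
move=> t t' e; rewrite (rec t) (rec t'); apply: eq_bigr => p _; congr (_ ⊗ _).
apply: val_inj; apply/boolp.funext => h.
have E (t0 : tensor (subv (finite_dual H)) (subv g)) :
    val (\sw_(f, χ <- t0) (val χ p.2 : k) *: f) h = eval2 t0 h p.2.
  rewrite (lin_swE (fun f : subv (finite_dual H) => val f h)); last by lin.
  rewrite -[RHS]/(\sw_(f, χ <- t0) (val f h * val χ p.2 : k^o)).
  apply: (eq_sw (U := k^o)) => f χ; rewrite mulrC.
  exact: (linZ _ f (lin_valapp (S := finite_dual H) h)).
by rewrite !E e.
Qed.

(** The tangent vector χ' of the axiom must be χ itself, as one sees at h' = 1,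
    where tangent vectors vanish. *)
Lemma coeffP χ h h' :
  \sw_(f, χ' <- qts_coeff hH χ) (val f h * val χ' h' : k^o) =
  val χ (h * h') - val χ h * ε h'.
Proof.
have [χ' hχ' [t ht]] := qts_comul hg (valP χ).
have e0 : \sw_(f, χ' <- t) (val f h * val χ' 1 : k^o) = 0.
  by rewrite /sw big1 // => p _; rewrite tangent1 mulr0.
suff: eval2 (qts_coeff hH χ) = fun h h' => val χ (h * h') - val χ h * ε h'.
  by move=> e; have := congr1 (fun F => F h h') e.
apply: (lift_alongP (i := @eval2 k H (finite_dual H) g)).
exists t; apply/boolp.funext => a; apply/boolp.funext => b.
have -> : val χ a = χ' a.
  have := ht a 1; rewrite mulr1 counit1 mulr1 => ->.
  by rewrite /eval2 big1 ?addr0 // => p _; rewrite tangent1 mulr0.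
by rewrite ht addrC addKr.
Qed.

Lemma lin_qts_coeff : linear (@qts_coeff k H hH g).
Proof.
move=> c u v; apply: eval2_inj.
apply/boolp.funext => h; apply/boolp.funext => h'; rewrite eval2_linear.
rewrite ![eval2 _ _ _]coeffP !(lin_valapp (S := g)).
by rewrite mulrDl opprD addrACA -scalerAl -scalerBr.
Qed.

Lemma End_of_tensor_inj : injective (@End_of_tensor k H g).
Proof.
have [s hs] := tangent_dual_basis.
have rec (t : tensor (subv g) H) :
    t = \sum_(p <- s) p.1 ⊗ End_of_tensor t p.2.
  rewrite -[LHS]sw_id.
  transitivity (\sw_(χ, n <- t) \sum_(p <- s) p.1 ⊗ ((val χ p.2 : k) *: n)).
    apply: eq_sw => χ n; rewrite [χ in LHS]hs (lin_sumE _ _ ((bil_pure _ _).2 n)).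
    apply: eq_bigr => p _.
    by rewrite (linZ _ _ ((bil_pure _ _).1 p.1)) (linZ _ _ ((bil_pure _ _).2 n)).
  rewrite sw_sum; apply: eq_bigr => p _.
  by rewrite (lin_sumE _ _ ((bil_pure _ _).1 p.1)).
by move=> t t' e; rewrite (rec t) (rec t') e.
Qed.

Lemma adP χ h : \sw_(χ', n <- qts_ad hH χ) (val χ' h : k) *: n =
  \sw_(x, y <- Δ h) \sw_(a, b <- Δ y) (val χ a : k) *: (x * S b).
Proof.
suff: End_of_tensor (qts_ad hH χ) = adjoint hH (val χ).
  by move=> e; have := congr1 (fun F => F h) e.
apply: (lift_alongP (i := @End_of_tensor k H g)).
by have [t ht] := bg (valP χ); exists t.
Qed.

Lemma lin_qts_ad : linear (@qts_ad k H hH g).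
Proof.
move=> c u v; apply: End_of_tensor_inj; apply/boolp.funext => h.
have l : linear (fun t : tensor (subv g) H => \sw_(χ', n <- t) (val χ' h : k) *: n).
  by lin.
rewrite [LHS]adP [RHS]l !adP.
have l' : linear (fun χ => \sw_(x, y <- Δ h) \sw_(a, b <- Δ y) (val χ a : k) *: (x * S b)).
  by lin.
exact: l'.
Qed.

(** ad(χ)(h_1) h_2 = h_1 χ(h_2), by the antipode axiom; the identity behind the
    colinearity of the Lie derivative of vertical fields. *)
Lemma ad_cancel U (f : H -> U) χ h : linear f ->
  \sw_(x, y <- Δ h) \sw_(χ', n <- qts_ad hH χ) (val χ' x : k) *: f (n * y) =
  \sw_(x, y <- Δ h) (val χ y : k) *: f x.
Proof.
move=> hf.
transitivity (\sw_(x, y <- Δ h) \sw_(a, z <- Δ x) \sw_(c, e <- Δ z)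
    (val χ c : k) *: f (a * S e * y)).
  apply: eq_sw => x y.
  transitivity (f ((\sw_(χ', n <- qts_ad hH χ) (val χ' x : k) *: n) * y)).
    rewrite (lin_swE (fun v => f (v * y))); last by lin.
    by apply: eq_sw => χ' n; rewrite -scalerAl (linZ _ _ hf).
  rewrite adP (lin_swE (fun v => f (v * y))); last by lin.
  apply: eq_sw => a z; rewrite (lin_swE (fun v => f (v * y))); last by lin.
  by apply: eq_sw => c e; rewrite -scalerAl (linZ _ _ hf).
rewrite comul_assoc; last by trilin.
apply: eq_sw => a y'.
rewrite comul_assoc; last by trilin.
rewrite -[RHS](comul_counitr hH (fun c => (val χ c : k) *: f a)); last by lin.
apply: eq_sw => c z.
rewrite -[a in RHS]mulr1.
rewrite -(sw_antipodel hH (fun v => (val χ c : k) *: f (a * v))); last by lin.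
by apply: eq_sw => e y; rewrite mulrA.
Qed.

End TangentSpace.

(** * Vertical vector fields *)

Section Translation.
Variables (k : fieldType) (H : algType k) (hH : hopf H).
Variables (Sinv : H -> H) (SinvK : cancel Sinv (antipode hH)).
Variables (A : algType k) (cA : comodule_algebra hH A).
Local Notation S := (antipode hH).
Local Notation δA := (coact cA).

Lemma galois_section (galA : hopf_galois cA) (t : tensor A H) :
  exists s : seq (A * A),
    \sum_(p <- s) \sw_(b, h <- δA p.2) (p.1 * b) ⊗ h = t.
Proof. by have [f _ fK] := galA; exists (legs (f t)); have := fK t. Qed.

(** The map a ⊗ h |-> a_0 ⊗ a_1 S(h) takes a a'_0 ⊗ a'_1, the image of the
    canonical map, to a_0 a' ⊗ a_1, and takes 1 ⊗ S^{-1}(h) to 1 ⊗ h. *)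
Lemma galois_translation (galA : hopf_galois cA) (h : H) :
  exists s : seq (A * A),
    \sum_(p <- s) \sw_(b, c <- δA p.1) (b * p.2) ⊗ c = 1 ⊗ h.
Proof.
have [s hs] := galois_section galA (1 ⊗ Sinv h).
exists s.
pose twist (t : tensor A H) := \sw_(a, h <- t) \sw_(b, c <- δA a) b ⊗ (c * S h).
have twistl : linear twist by rewrite /twist; lin.
transitivity (twist (1 ⊗ Sinv h)); last first.
  by rewrite /twist sw_pure ?coact1 ?sw_pure ?SinvK ?mul1r //; lin.
rewrite -hs (lin_sumE _ _ twistl); apply: eq_bigr => p _.
rewrite (lin_swE twist) //.
transitivity (\sw_(a, e <- δA p.2) \sw_(x, y <- δA p.1) \sw_(b, c <- δA a)
   (x * b) ⊗ (y * c * S e)); last first.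
  apply: eq_sw => a e; rewrite /twist sw_pure; last by lin.
  by rewrite sw_coactM //; lin.
rewrite exchange_sw; apply: eq_sw => x y.
rewrite (rcoact_assoc (coact_rcomodule cA)); last by trilin.
rewrite -[LHS](sw_rcounit (coact_rcomodule cA) (fun b => (x * b) ⊗ y)) ;
  last by lin.
apply: eq_sw => b e.
rewrite -[y in LHS]mulr1.
rewrite -(sw_antipoder hH (fun v => (x * b) ⊗ (y * v))); last by lin.
by apply: eq_sw => c c'; rewrite mulrA.
Qed.

End Translation.

Section VerticalFields.
Variables (k : fieldType) (H : algType k) (hH : hopf H).
Variables (g : submodClosed (H -> k^o)).
Hypotheses (hg : is_quantum_tangent_space hH g) (bg : bicovariant_qts hH g).
Variables (A : algType k) (cA : comodule_algebra hH A).
Local Notation Δ := (comul hH).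
Local Notation ε := (counit hH).
Local Notation δA := (coact cA).
Local Notation X := (vertical_fields g cA).
Implicit Types (U : lmodType k) (χ : subv g).

Let cl := lin_qts_coeff hg.
Let al := lin_qts_ad hg bg.

Lemma vfield_lactE a (x : X) :
  lact a x = \sw_(a', χ <- (x : tensor A (subv g))) (a * a') ⊗ χ.
Proof. by []. Qed.

Lemma vfield_lieE (x : X) a :
  lie x a = \sw_(a', χ <- (x : tensor A (subv g))) \sw_(b, h <- δA a)
    (val χ h : k) *: (a' * b).
Proof. by []. Qed.

Lemma vfield_ractE (x : X) a :
  ract x a = \sw_(a', χ <- (x : tensor A (subv g))) \sw_(b, h <- δA a)
    \sw_(f, χ' <- qts_coeff hH χ) ((val f h : k) *: (a' * b)) ⊗ χ'.
Proof. by []. Qed.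

Lemma vfield_rcoactE (x : X) :
  vf_rcoact x = \sw_(a', χ <- (x : tensor A (subv g))) \sw_(b, h <- δA a')
    \sw_(χ', n <- qts_ad hH χ) b ⊗ χ' ⊗ (h * n).
Proof. by []. Qed.

Lemma vfield_lact_pure a a' χ : lact a (a' ⊗ χ : X) = (a * a') ⊗ χ.
Proof. by rewrite vfield_lactE sw_pure //; lin. Qed.

Lemma vfield_lie_pure a χ b :
  lie (a ⊗ χ : X) b = \sw_(c, h <- δA b) (val χ h : k) *: (a * c).
Proof. by rewrite vfield_lieE sw_pure //; lin. Qed.

Lemma vfield_ract_pure a χ b :
  ract (a ⊗ χ : X) b = \sw_(c, h <- δA b) \sw_(f, χ' <- qts_coeff hH χ)
    ((val f h : k) *: (a * c)) ⊗ χ'.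
Proof. by rewrite vfield_ractE sw_pure //; lin. Qed.

Lemma bil_vfield_lact : bilinear_map (@lact k A X).
Proof.
suff l : bilinear_map (fun a (x : tensor A (subv g)) =>
    \sw_(a', χ <- x) (a * a') ⊗ χ) by exact: l.
by lin.
Qed.

Lemma bil_vfield_lie : bilinear_map (@lie k H A X).
Proof.
suff l : bilinear_map (fun (x : tensor A (subv g)) a =>
    \sw_(a', χ <- x) \sw_(b, h <- δA a) (val χ h : k) *: (a' * b)) by exact: l.
by lin.
Qed.

Lemma bil_vfield_ract : bilinear_map (@ract k A X).
Proof.
suff l : bilinear_map (fun (x : tensor A (subv g)) a =>
    \sw_(a', χ <- x) \sw_(b, h <- δA a)
    \sw_(f, χ' <- qts_coeff hH χ) ((val f h : k) *: (a' * b)) ⊗ χ') by exact: l.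
by lin.
Qed.

Lemma lin_vfield_rcoact : linear (@vf_rcoact k H A X).
Proof.
suff l : linear (fun (x : tensor A (subv g)) => \sw_(a', χ <- x) \sw_(b, h <- δA a')
    \sw_(χ', n <- qts_ad hH χ) b ⊗ χ' ⊗ (h * n)) by exact: l.
by lin.
Qed.

Let bl := bil_vfield_lact.
Let br := bil_vfield_ract.
Let bL := bil_vfield_lie.

Lemma vfield_ext U (f f' : X -> U) : linear f -> linear f' ->
  (forall a χ, f (a ⊗ χ) = f' (a ⊗ χ)) -> forall x, f x = f' x.
Proof. exact: tensor_ext. Qed.

Lemma vfield_lract a (x : X) b : ract (lact a x) b = lact a (ract x b).
Proof.
move: x; apply: vfield_ext; try by lin.
move=> c χ; rewrite vfield_lact_pure !vfield_ract_pure.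
rewrite (lin_swE (lact a)) //; last by lin.
apply: eq_sw => e h; rewrite (lin_swE (lact a)); last by lin.
by apply: eq_sw => f χ'; rewrite vfield_lact_pure -scalerAr mulrA.
Qed.

Lemma vfield_lie_lact a (x : X) b : lie (lact a x) b = a * lie x b.
Proof.
move: x; apply: vfield_ext; try by lin.
move=> c χ; rewrite vfield_lact_pure !vfield_lie_pure (lin_swE (GRing.mul a));
  last by lin.
by apply: eq_sw => e h; rewrite -scalerAr mulrA.
Qed.

Lemma vfield_lie1 (x : X) : lie x 1 = 0.
Proof.
move: x; apply: vfield_ext; try by lin.
move=> a χ; rewrite vfield_lie_pure coact1 sw_pure; last by lin.
by rewrite (tangent1 hg) scale0r.
Qed.

Lemma vfield_leibniz (x : X) a b :
  lie x (a * b) = lie x a * b + lie (ract x a) b.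
Proof.
move: x; apply: vfield_ext; try by lin.
move=> e χ; rewrite !vfield_lie_pure vfield_ract_pure.
rewrite sw_coactM; last by lin.
rewrite (lin_swE (fun v => v * b)); last by lin.
rewrite (lin_swE (fun y : X => lie y b)); last by lin.
rewrite sw_add; apply: eq_sw => c h.
rewrite (lin_swE (fun y : X => lie y b)); last by lin.
under [X in _ = _ + X]eq_sw => f χ' do rewrite vfield_lie_pure.
rewrite exchange_sw -[b in X in X + _](rcoact_counit (coact_rcomodule cA)).
rewrite (lin_sumE (f := fun v => (val χ h *: (e * c)) * v)); last by lin.
rewrite -[X in X + _]/(\sw_(u, v <- δA b) (val χ h *: (e * c)) * (ε v *: u)) sw_add.
apply: eq_sw => u v.
transitivity ((val χ h * ε v + (val χ (h * v) - val χ h * ε v) : k) *: (e * (c * u))).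
  by rewrite addrC subrK.
rewrite scalerDl -coeffP //; congr (_ + _).
  by rewrite -scalerAr -!scalerAl scalerA mulrC mulrA.
rewrite (lin_swE (fun z : k^o => (z : k) *: (e * (c * u)))); last first.
  by apply: (@lin_scalel _ _ _ (fun z : k^o => z)).
by apply: eq_sw => f χ'; rewrite -scalerAl scalerA mulrA mulrC.
Qed.

Lemma vfield_lie_rcolinear (x : X) a :
  δA (lie x a) =
  \sw_(y, h <- vf_rcoact x) \sw_(b, n <- δA a) lie y b ⊗ (h * n).
Proof.
have rl := lin_vfield_rcoact.
move: x; apply: vfield_ext; try by lin.
move=> e χ; rewrite vfield_lie_pure (lin_swE δA); last by lin.
rewrite vfield_rcoactE [in RHS]sw_pure; last by lin.
rewrite sw_sw; last by lin.
transitivity (\sw_(e0, e1 <- δA e) \sw_(c, h <- δA a) \sw_(x, y <- Δ h)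
   (val χ y : k) *: ((e0 * c) ⊗ (e1 * x))).
  rewrite exchange_sw; under [RHS]eq_sw => c h do rewrite exchange_sw.
  rewrite -(rcoact_assoc (coact_rcomodule cA)); last by trilin.
  apply: eq_sw => c h; rewrite (linZ _ _ (lin_coact cA)) -[δA (e * c)]sw_id.
  rewrite sw_coactM; last by lin.
  rewrite (lin_swE (fun v => (val χ h : k) *: v)); last by lin.
  rewrite exchange_sw; apply: eq_sw => c0 c1.
  by rewrite (lin_swE (fun v => (val χ h : k) *: v)) //; lin.
apply: eq_sw => e0 e1.
rewrite sw_sw; last by lin.
transitivity (\sw_(χ', n <- qts_ad hH χ) \sw_(b, m <- δA a)
    lie (e0 ⊗ χ' : X) b ⊗ (e1 * n * m));
  last by apply: eq_sw => χ' n; rewrite sw_pure //; lin.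
rewrite exchange_sw.
transitivity (\sw_(c, h <- δA a) \sw_(x, y <- Δ h) \sw_(χ', n <- qts_ad hH χ)
    (val χ' x : k) *: ((e0 * c) ⊗ (e1 * (n * y)))).
  apply: eq_sw => c h.
  by rewrite (ad_cancel hg bg (f := fun v => (e0 * c) ⊗ (e1 * v))) //; lin.
rewrite -(rcoact_assoc (coact_rcomodule cA)); last by trilin.
apply: eq_sw => b m; rewrite exchange_sw; apply: eq_sw => χ' n.
rewrite vfield_lie_pure (lin_swE (fun v => v ⊗ (e1 * n * m))); last by lin.
by apply: eq_sw => c h; rewrite (linZ _ _ ((bil_pure _ _).2 _)) mulrA.
Qed.

(** Elements of A ⊗ g carry their coefficient on the left of the function that
    they differentiate. Hence isolating χ(h) in L_{a ⊗ χ}(b) = a b_0 χ(b_1) takes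
    multiplication on the right, and elements b_0 b' ⊗ b_1 that sum to 1 ⊗ h. *)
Hypothesis trans : forall h : H, exists s : seq (A * A),
  \sum_(p <- s) \sw_(b, c <- δA p.1) (b * p.2) ⊗ c = 1 ⊗ h.

(** Sums of L_x(b) b' over the elements representing 1 ⊗ h recover the contraction
    of x with h; by a dual basis of g these contractions determine x. *)
Lemma vfield_lie_inj (W : lmodType k) (t : tensor X W) :
  (forall a, \sw_(x, w <- t) lie x a ⊗ w = 0) -> t = 0.
Proof.
move=> ht.
have [s hs] := tangent_dual_basis hg.
have coord h : \sw_(x, w <- t) \sw_(a, χ <- (x : tensor A (subv g)))
    ((val χ h : k) *: a) ⊗ w = 0.
  have [r hr] := trans h.
  pose contr a χ w (y : tensor A H) : tensor A W :=
    \sw_(b, c <- y) ((val χ c : k) *: (a * b)) ⊗ w.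
  have contrl a χ w : linear (contr a χ w) by rewrite /contr; lin.
  transitivity (\sw_(x, w <- t) \sw_(a, χ <- (x : tensor A (subv g))) contr a χ w (1 ⊗ h)).
    by apply: eq_sw => x w; apply: eq_sw => a χ; rewrite /contr sw_pure ?mulr1 //; lin.
  rewrite -hr.
  transitivity (\sum_(p <- r) \sw_(u, w <- \sw_(x, w <- t) lie x p.1 ⊗ w) (u * p.2) ⊗ w);
    last by rewrite big1 // => p _; rewrite ht (linear_at0 (lin_sw _)) //; lin.
  under eq_sw => x w do
    (under eq_sw => a χ do rewrite (lin_sumE _ _ (contrl _ _ _)); rewrite sw_sum).
  rewrite sw_sum; apply: eq_bigr => p _.
  rewrite sw_sw; last by lin.
  apply: eq_sw => x w; rewrite sw_pure; last by lin.
  rewrite vfield_lieE (lin_swE (fun u => (u * p.2) ⊗ w)); last by lin.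
  apply: eq_sw => a χ; rewrite (lin_swE (fun u => (u * p.2) ⊗ w)); last by lin.
  rewrite (lin_swE (contr a χ w)) //; apply: eq_sw => b c.
  by rewrite /contr sw_pure ?scalerAl ?mulrA //; lin.
rewrite -[t]sw_id.
transitivity (\sum_(p <- s) \sw_(a, w <- (\sw_(x, w <- t)
    \sw_(a, χ <- (x : tensor A (subv g))) ((val χ p.2 : k) *: a) ⊗ w)) (a ⊗ p.1 : X) ⊗ w);
  last by rewrite big1 // => p _; rewrite coord (linear_at0 (lin_sw _)) //; lin.
transitivity (\sw_(x, w <- t) \sum_(p <- s) \sw_(a, χ <- (x : tensor A (subv g)))
   (((val χ p.2 : k) *: a) ⊗ p.1 : X) ⊗ w).
  apply: eq_sw => x w; move: x; apply: vfield_ext; try by lin.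
  move=> a χ; rewrite {1}[χ]hs (lin_sumE (f := fun χ => (a ⊗ χ : X) ⊗ w));
    last by lin.
  apply: eq_bigr => p _; rewrite sw_pure; last by lin.
  by rewrite (linZ _ _ ((bil_pure _ _).1 a)) (linZ _ _ ((bil_pure _ _).2 p.1)).
rewrite sw_sum; apply: eq_bigr => p _.
rewrite sw_sw; last by lin.
apply: eq_sw => x w; rewrite sw_sw; last by lin.
by apply: eq_sw => a χ; rewrite sw_pure //; lin.
Qed.

Lemma vertical_fields_rfovc : is_rfovc cA X.
Proof.
apply: rfovc_of_lie.
- exact: bil_vfield_lact.
- exact: bil_vfield_ract.
- exact: bil_vfield_lie.
- exact: lin_vfield_rcoact.
- exact: vfield_lie_lact.
- exact: vfield_lie1.
- exact: vfield_leibniz.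
- exact: vfield_lie_rcolinear.
- exact: vfield_lie_inj.
Qed.

End VerticalFields.

(** * Vertical forms *)

Section VerticalForms.
Variables (k : fieldType) (H : algType k) (hH : hopf H).
Variables (A : algType k) (cA : comodule_algebra hH A).
Variables (G : BiFODC H) (hG : is_bifodc hH G).
Local Notation Δ := (comul hH).
Local Notation ε := (counit hH).
Local Notation δA := (coact cA).
Local Notation Λ := (subv (left_coinvariants hG)).
Local Notation Y := (vertical_forms cA hG).
Local Notation ϖ := (maurer_cartan hG).
Implicit Types (U : lmodType k) (θ : Λ).

Let br' : bilinear_map (@coinv_ract k H hH G hG) := bil_coinv_ract hG.
Let ml : linear ϖ := lin_maurer_cartan hG.
Let rl : linear (@coinv_rcoact k H hH G hG) := @lin_coinv_rcoact k H hH G hG.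

Lemma vform_ext U (f f' : Y -> U) : linear f -> linear f' ->
  (forall a θ, f (a ⊗ θ) = f' (a ⊗ θ)) -> forall y, f y = f' y.
Proof. exact: tensor_ext. Qed.

Lemma vform_lactE a (y : Y) :
  lact a y = \sw_(c, θ <- (y : tensor A Λ)) (a * c) ⊗ θ.
Proof. by []. Qed.

Lemma vform_ractE (y : Y) a :
  ract y a = \sw_(c, θ <- (y : tensor A Λ)) \sw_(b, h <- δA a)
    (c * b) ⊗ coinv_ract θ h.
Proof. by []. Qed.

Lemma vform_diffE a : diff Y a = \sw_(b, h <- δA a) b ⊗ ϖ h.
Proof. by []. Qed.

Lemma vform_rcoactE (y : Y) :
  form_rcoact y = \sw_(c, θ <- (y : tensor A Λ)) \sw_(b, h <- δA c)
    \sw_(θ', n <- coinv_rcoact θ) b ⊗ θ' ⊗ (h * n).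
Proof. by []. Qed.

Lemma bil_vform_lact : bilinear_map (@lact k A Y).
Proof.
suff l : bilinear_map (fun a (y : tensor A Λ) =>
    \sw_(c, θ <- y) (a * c) ⊗ θ) by exact: l.
by lin.
Qed.

Lemma bil_vform_ract : bilinear_map (@ract k A Y).
Proof.
suff l : bilinear_map (fun (y : tensor A Λ) a =>
    \sw_(c, θ <- y) \sw_(b, h <- δA a) (c * b) ⊗ coinv_ract θ h) by exact: l.
by lin.
Qed.

Lemma lin_vform_rcoact : linear (@form_rcoact k H A Y).
Proof.
suff l : linear (fun (y : tensor A Λ) => \sw_(c, θ <- y) \sw_(b, h <- δA c)
    \sw_(θ', n <- coinv_rcoact θ) b ⊗ θ' ⊗ (h * n)) by exact: l.
by lin.
Qed.

Lemma lin_vform_diff : linear (diff Y).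
Proof.
suff l : linear (fun a => \sw_(b, h <- δA a) b ⊗ ϖ h) by exact: l.
by lin.
Qed.

Let bl := bil_vform_lact.
Let br := bil_vform_ract.
Let dl := lin_vform_diff.
Let δl := lin_vform_rcoact.

Lemma vform_lact_pure a c θ : lact a (c ⊗ θ : Y) = (a * c) ⊗ θ.
Proof. by rewrite vform_lactE sw_pure //; lin. Qed.

Lemma vform_ract_pure c θ a :
  ract (c ⊗ θ : Y) a = \sw_(b, h <- δA a) (c * b) ⊗ coinv_ract θ h.
Proof. by rewrite vform_ractE sw_pure //; lin. Qed.

Lemma vform_bimodule : is_bimodule Y.
Proof.
split=> //.
- apply: vform_ext; try by lin.
  by move=> a θ; rewrite vform_lact_pure mul1r.
- move=> a b; apply: vform_ext; try by lin.
  by move=> c θ; rewrite !vform_lact_pure mulrA.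
- apply: vform_ext; try by lin.
  move=> a θ; rewrite vform_ract_pure coact1 sw_pure; last by lin.
  by rewrite mulr1 coinv_ract1.
- move=> a b; apply: vform_ext; try by lin.
  move=> c θ; rewrite !vform_ract_pure sw_coactM; last by lin.
  rewrite (lin_swE (fun y : Y => ract y b)); last by lin.
  apply: eq_sw => e h; rewrite vform_ract_pure; apply: eq_sw => e' h'.
  by rewrite coinv_ractM mulrA.
- move=> a b; apply: vform_ext; try by lin.
  move=> c θ; rewrite vform_lact_pure !vform_ract_pure (lin_swE (lact a));
    last by lin.
  by apply: eq_sw => e h; rewrite vform_lact_pure mulrA.
Qed.

Lemma vform_leibniz a b :
  diff Y (a * b) = ract (diff Y a) b + lact a (diff Y b).
Proof.
rewrite !vform_diffE sw_coactM; last by lin.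
rewrite (lin_swE (fun y : Y => ract y b)); last by lin.
rewrite -[a in X in _ + X](rcoact_counit (coact_rcomodule cA)).
rewrite (lin_sumE _ _ (bl.2 _)).
rewrite -[X in _ + X]/(\sw_(c, h <- δA a)
  lact (ε h *: c) (\sw_(e, n <- δA b) e ⊗ ϖ n : Y)).
rewrite sw_add; apply: eq_sw => c h.
rewrite vform_ract_pure (lin_swE (lact (ε h *: c))); last by lin.
rewrite sw_add; apply: eq_sw => e n.
rewrite vform_lact_pure maurer_cartanM (linD _ _ ((bil_pure _ _).1 _)).
by rewrite -scalerAl (linZ _ _ ((bil_pure _ _).1 _)) (linZ _ _ ((bil_pure _ _).2 _)).
Qed.

Lemma vform_rcoact_lact a (y : Y) :
  form_rcoact (lact a y) =
  \sw_(x, h <- δA a) \sw_(v, z <- form_rcoact y) lact x v ⊗ (h * z).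
Proof.
move: y; apply: vform_ext; try by lin.
move=> c θ; rewrite vform_lact_pure !vform_rcoactE !sw_pure; try by lin.
rewrite sw_coactM; last by lin.
apply: eq_sw => x h; rewrite sw_sw; last by lin.
apply: eq_sw => u v; rewrite sw_sw; last by lin.
apply: eq_sw => θ' n; rewrite sw_pure; last by lin.
by rewrite vform_lact_pure mulrA.
Qed.

Lemma vform_rcoact_diff a :
  form_rcoact (diff Y a) = \sw_(x, h <- δA a) diff Y x ⊗ h.
Proof.
rewrite vform_rcoactE vform_diffE sw_sw; last by lin.
transitivity (\sw_(b, h <- δA a) \sw_(c, x <- δA b) \sw_(θ, n <- coinv_rcoact (ϖ h))
    c ⊗ θ ⊗ (x * n)).
  by apply: eq_sw => b h; rewrite sw_pure //; lin.
rewrite (rcoact_assoc (coact_rcomodule cA)); last by trilin.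
transitivity (\sw_(b, h <- δA a) \sw_(x, y <- Δ h) b ⊗ ϖ x ⊗ y).
  apply: eq_sw => b h.
  by rewrite (maurer_cartan_rcolinear (F := fun θ n => b ⊗ θ ⊗ n)) //; lin.
rewrite -(rcoact_assoc (coact_rcomodule cA)); last by trilin.
apply: eq_sw => b h; rewrite vform_diffE (lin_swE (fun y : Y => y ⊗ h)) //; lin.
Qed.

(** a ⊗ ϖ(h) is the sum of a' db' over a preimage of a ⊗ h under the canonical
    map. *)
Lemma vform_span (galA : hopf_galois cA) (w : Y) :
  exists s : seq (A * A), w = \sum_(p <- s) lact p.1 (diff Y p.2).
Proof.
have spanD (w1 w2 : Y) :
    (exists s : seq (A * A), w1 = \sum_(p <- s) lact p.1 (diff Y p.2)) ->
    (exists s : seq (A * A), w2 = \sum_(p <- s) lact p.1 (diff Y p.2)) ->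
    exists s : seq (A * A), w1 + w2 = \sum_(p <- s) lact p.1 (diff Y p.2).
  by move=> [s1 ->] [s2 ->]; exists (s1 ++ s2); rewrite big_cat.
rewrite -[w]sw_id /sw.
elim: (legs _) => [|[a θ] r ih]; first by exists [::]; rewrite !big_nil.
rewrite big_cons; apply: spanD => //; cbn [fst snd].
have [h ->] := maurer_cartan_surj θ.
have [s hs] := galois_section galA (a ⊗ h).
exists s.
have fl : linear (fun t : tensor A H => \sw_(b, h <- t) b ⊗ ϖ h) by lin.
have -> : a ⊗ ϖ h = \sw_(b, h <- a ⊗ h) b ⊗ ϖ h by rewrite sw_pure //; lin.
rewrite -hs (lin_sumE _ _ fl); apply: eq_bigr => p _.
rewrite vform_diffE sw_sw; last by lin.
rewrite (lin_swE (lact p.1)); last by lin.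
by apply: eq_sw => b n; rewrite sw_pure ?vform_lact_pure //; lin.
Qed.

Lemma vertical_forms_rfodc (galA : hopf_galois cA) : is_rfodc cA Y.
Proof.
split.
- apply: rcovariant_of_diff.
  + exact: vform_bimodule.
  + exact: dl.
  + exact: vform_leibniz.
  + exact: vform_span.
  + exact: δl.
  + exact: vform_rcoact_lact.
  + exact: vform_rcoact_diff.
- exact: dl.
- exact: vform_leibniz.
- exact: vform_span.
- exact: vform_rcoact_diff.
Qed.

End VerticalForms.

(** * Duality from a pairing with a dual basis *)

Section Transport.
Variables (k : fieldType) (H : algType k) (hH : hopf H).
Variables (A : algType k) (cA : comodule_algebra hH A).
Local Notation δA := (coact cA).

Section Bimod.
Variables (M N : Bimodule A) (Φ : M -> N).
Hypothesis Φl : linear Φ.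
Hypothesis Φbij : bijective Φ.
Hypothesis Φlact : forall a m, Φ (lact a m) = lact a (Φ m).
Hypothesis Φract : forall m a, Φ (ract m a) = ract (Φ m) a.

Lemma transport_bimodule : is_bimodule M -> is_bimodule N.
Proof.
move=> hM; have [f Φf fΦ] := Φbij.
have fl : linear f by move=> c u v; apply: (can_inj Φf); rewrite Φl !fΦ.
have bl := lact_bilinear hM; have br := ract_bilinear hM.
split.
- split=> [a|n].
    apply: (eq_lin (g := fun n => Φ (lact a (f n)))); last by lin.
    by move=> n; rewrite Φlact fΦ.
  apply: (eq_lin (g := fun a => Φ (lact a (f n)))); last by lin.
  by move=> a; rewrite Φlact fΦ.
- split=> [n|a].
    apply: (eq_lin (g := fun a => Φ (ract (f n) a))); last by lin.
    by move=> a; rewrite Φract fΦ.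
  apply: (eq_lin (g := fun n => Φ (ract (f n) a))); last by lin.
  by move=> n; rewrite Φract fΦ.
- by move=> n; rewrite -[n]fΦ -Φlact (lact1 hM).
- by move=> a b n; rewrite -[n]fΦ -!Φlact (lactM hM).
- by move=> n; rewrite -[n]fΦ -Φract (ract1 hM).
- by move=> a b n; rewrite -[n]fΦ -!Φract (ractM hM).
- by move=> a b n; rewrite -[n]fΦ -!(Φract, Φlact) (lract hM).
Qed.

Variables (δM : M -> tensor M H) (δN : N -> tensor N H).
Hypothesis Φδ : forall m, δN (Φ m) = \sw_(p, q <- δM m) Φ p ⊗ q.

Lemma transport_rcovariant :
  is_rcovariant_bimodule cA δM -> is_rcovariant_bimodule cA δN.
Proof.
move=> hM; have [f Φf fΦ] := Φbij.
have fl : linear f by move=> c u v; apply: (can_inj Φf); rewrite Φl !fΦ.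
have hδ := rcov_comodule hM; have δl := rcoact_linear hδ.
have δNl : linear δN.
  apply: (eq_lin (g := fun n => \sw_(p, q <- δM (f n)) Φ p ⊗ q)); last by lin.
  by move=> n; rewrite -Φδ fΦ.
have bN := transport_bimodule (rcov_bimodule hM).
have bl := lact_bilinear bN; have br := ract_bilinear bN.
split=> //.
  split=> // n; rewrite -[n]fΦ.
  - rewrite -[LHS]/(\sw_(p, q <- δN (Φ (f n))) \sw_(a, b <- δN p) a ⊗ b ⊗ q).
    rewrite -[RHS]/(\sw_(p, q <- δN (Φ (f n))) \sw_(a, b <- comul hH q) p ⊗ a ⊗ b).
    rewrite !Φδ !sw_sw; try by lin.
    transitivity (\sw_(p, q <- δM (f n)) \sw_(a, b <- δM p) Φ a ⊗ b ⊗ q).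
      apply: eq_sw => p q; rewrite sw_pure; last by lin.
      rewrite Φδ sw_sw; last by lin.
      by apply: eq_sw => a b; rewrite sw_pure //; lin.
    rewrite (rcoact_assoc hδ); last by trilin.
    by apply: eq_sw => p q; rewrite sw_pure //; lin.
  - rewrite -[LHS]/(\sw_(p, q <- δN (Φ (f n))) counit hH q *: p).
    rewrite Φδ sw_sw; last by lin.
    rewrite -[RHS](sw_rcounit hδ Φ) //; apply: eq_sw => p q.
    by rewrite sw_pure //; lin.
move=> a n b; rewrite -[n]fΦ -Φlact -Φract Φδ.
rewrite -[RHS]/(\sw_(x, y <- δA a) \sw_(v, z <- δN (Φ (f n))) \sw_(x', y' <- δA b)
  ract (lact x v) x' ⊗ (y * z * y')).
rewrite (rcov_compat hM) -[X in sw X]/(\sw_(x, y <- δA a) \sw_(v, z <- δM (f n))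
  \sw_(x', y' <- δA b) ract (lact x v) x' ⊗ (y * z * y')).
rewrite sw_sw; last by lin.
apply: eq_sw => x y; rewrite Φδ !sw_sw; try by lin.
apply: eq_sw => v z; rewrite sw_sw ?sw_pure; try by lin.
by apply: eq_sw => x' y'; rewrite sw_pure ?Φract ?Φlact //; lin.
Qed.

End Bimod.

Lemma transport_rfovc (X X' : RFOVC H A) (Φ : X -> X') :
  linear Φ -> bijective Φ ->
  (forall a x, Φ (lact a x) = lact a (Φ x)) ->
  (forall x a, Φ (ract x a) = ract (Φ x) a) ->
  (forall x a, lie (Φ x) a = lie x a) ->
  (forall x, vf_rcoact (Φ x) = \sw_(p, q <- vf_rcoact x) Φ p ⊗ q) ->
  is_rfovc cA X -> rfovc_isomorphic cA X X'.
Proof.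
move=> Φl Φbij Φlact Φract Φlie Φδ hX; have [f Φf fΦ] := Φbij.
have fl : linear f by move=> c u v; apply: (can_inj Φf); rewrite Φl !fΦ.
have bL := lie_bilinear hX.
have bL' : bilinear_map (@lie k H A X').
  split=> [x|a].
    apply: (eq_lin (g := fun a => lie (f x) a)); last by lin.
    by move=> a; rewrite -Φlie fΦ.
  apply: (eq_lin (g := fun x => lie (f x) a)); last by lin.
  by move=> x; rewrite -Φlie fΦ.
split=> //.
  split.
  - exact: (transport_rcovariant Φl Φbij Φlact Φract Φδ (rfovc_rcov hX)).
  - exact: bL'.
  - move=> x y; rewrite -[x]fΦ -[y]fΦ => e; congr Φ.
    by apply: (lie_inj hX); apply/boolp.funext => a; rewrite -!Φlie e.
  - by move=> a x b; rewrite -[x]fΦ -Φlact !Φlie (lie_lact hX).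
  - by move=> x a b; rewrite -[x]fΦ -Φract !Φlie (lie_leibniz hX).
  - move=> x a; rewrite -[x]fΦ Φlie (lie_rcolinear hX).
    rewrite -[LHS]/(\sw_(p, q <- vf_rcoact (f x)) \sw_(b, h <- δA a) lie p b ⊗ (q * h)).
    rewrite -[RHS]/(\sw_(p, q <- vf_rcoact (Φ (f x)))
      \sw_(b, h <- δA a) lie p b ⊗ (q * h)).
    rewrite Φδ sw_sw; last by lin.
    apply: eq_sw => p q; rewrite sw_pure; last by lin.
    by apply: eq_sw => b h; rewrite Φlie.
exists Φ; split=> //; split=> // a x b.
by rewrite Φract Φlact.
Qed.

Lemma transport_rfodc (G G' : RFODC H A) (Φ : G -> G') :
  linear Φ -> bijective Φ ->
  (forall a x, Φ (lact a x) = lact a (Φ x)) ->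
  (forall x a, Φ (ract x a) = ract (Φ x) a) ->
  (forall a, Φ (diff G a) = diff G' a) ->
  (forall x, form_rcoact (Φ x) = \sw_(p, q <- form_rcoact x) Φ p ⊗ q) ->
  is_rfodc cA G -> rfodc_isomorphic cA G G'.
Proof.
move=> Φl Φbij Φlact Φract Φd Φδ hG; have [f Φf fΦ] := Φbij.
have dl := diff_linear hG.
split=> //.
  split.
  - exact: (transport_rcovariant Φl Φbij Φlact Φract Φδ (rfodc_rcov hG)).
  - by apply: (eq_lin (g := fun a => Φ (diff G a))) => [a|]; [rewrite Φd | lin].
  - by move=> a b; rewrite -!Φd -Φract -Φlact -(linD _ _ Φl) (diff_leibniz hG).
  - move=> w; have [s hs] := diff_span hG (f w); exists s.
    rewrite -[LHS]fΦ hs (lin_sumE _ _ Φl); apply: eq_bigr => p _.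
    by rewrite Φlact Φd.
  - move=> a; rewrite -Φd Φδ (diff_rcolinear hG).
    rewrite -[RHS]/(\sw_(b, h <- δA a) diff G' b ⊗ h).
    rewrite -[X in sw X]/(\sw_(b, h <- δA a) diff G b ⊗ h) sw_sw; last by lin.
    by apply: eq_sw => b h; rewrite sw_pure ?Φd //; lin.
exists Φ; split=> //; split=> // a x b.
by rewrite Φract Φlact.
Qed.

End Transport.

Section Duality.
Variables (k : fieldType) (H : algType k) (hH : hopf H).
Variables (Sinv : H -> H).
Hypotheses (SK : cancel (antipode hH) Sinv) (SinvK : cancel Sinv (antipode hH)).
Variables (A : algType k) (cA : comodule_algebra hH A).
Variables (X : RFOVC H A) (G : RFODC H A).
Hypotheses (hX : is_rfovc cA X) (hG : is_rfodc cA G).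
Local Notation S := (antipode hH).
Local Notation δA := (coact cA).
Local Notation δX := (@vf_rcoact k H A X).
Local Notation δG := (@form_rcoact k H A G).

Variable B : X -> G -> A.
Hypothesis Bb : bilinear_map B.
Hypothesis Bmid : forall x a w, B (ract x a) w = B x (lact a w).
Hypothesis Bl : forall a x w, B (lact a x) w = a * B x w.
Hypothesis Bd : forall x a, B x (diff G a) = lie x a.
Variable s : seq (X * G).
Hypothesis sX : forall x, x = \sum_(p <- s) lact (B x p.2) p.1.
Hypothesis sG : forall w, w = \sum_(p <- s) ract p.2 (B p.1 w).

Let hbG := rcov_bimodule (rfodc_rcov hG).
Let hbX := rcov_bimodule (rfovc_rcov hX).
Let blG : bilinear_map (@lact k A G) := lact_bilinear hbG.
Let brG : bilinear_map (@ract k A G) := ract_bilinear hbG.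
Let blX : bilinear_map (@lact k A X) := lact_bilinear hbX.
Let brX : bilinear_map (@ract k A X) := ract_bilinear hbX.
Let dl : linear (diff G) := diff_linear hG.
Let bL : bilinear_map (@lie k H A X) := lie_bilinear hX.
Let δXl : linear δX := rcoact_linear (rcov_comodule (rfovc_rcov hX)).
Let δGl : linear δG := rcoact_linear (rcov_comodule (rfodc_rcov hG)).

Let dR b : δG (diff G b) = \sw_(c, h <- δA b) diff G c ⊗ h :=
  diff_rcolinear hG b.

(** On w = a db, by B (x, a db) = L_{xa}(b) and the Leibniz rules of both
    calculi. *)
Lemma pairing_ract x w c : B x (ract w c) = B x w * c.
Proof.
move: w; apply: (span_ext (diff_span hG)); try by lin.
move=> a b; rewrite (lract hbG).
have -> : ract (diff G b) c = diff G (b * c) - lact b (diff G c).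
  by rewrite (diff_leibniz hG) addrK.
rewrite -!Bmid (linB _ _ (Bb.1 _)) -Bmid !Bd (lie_leibniz hX).
by rewrite addrK.
Qed.

(** On w = a db this is the colinearity of L_{xa}(b). *)
Lemma pairing_coact x w :
  δA (B x w) = \sw_(y, h <- δX x) \sw_(v, n <- δG w) B y v ⊗ (h * n).
Proof.
move: w; apply: (span_ext (diff_span hG)); try by lin.
move=> a b; rewrite -Bmid Bd (lie_rcolinear hX).
rewrite -[LHS]/(\sw_(y, h <- δX (ract x a)) \sw_(c, n <- δA b) lie y c ⊗ (h * n)).
rewrite (sw_rcoact_ract (rfovc_rcov hX)); last by lin.
apply: eq_sw => y h.
rewrite (sw_rcoact_lact (rfodc_rcov hG)); last by lin.
apply: eq_sw => c n.
rewrite dR sw_sw; last by lin.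
apply: eq_sw => e m; rewrite sw_pure; last by lin.
by rewrite -Bmid Bd mulrA.
Qed.

Lemma rhomP (M : Bimodule A) (f : M -> A) :
  is_rhom f -> f \in rHom M.
Proof. by move=> h; apply/subspaceP. Qed.

Lemma lhomP (M : Bimodule A) (f : M -> A) :
  is_lhom f -> f \in lHom M.
Proof. by move=> h; apply/subspaceP. Qed.

Lemma pairing_rhom x : is_rhom (B x).
Proof. by split=> [|w a]; [exact: Bb.1 | exact: pairing_ract]. Qed.

Lemma pairing_lhom w : is_lhom (B^~ w).
Proof. by split=> [|a x]; [exact: Bb.2 | exact: Bl]. Qed.

Definition to_rhom x : dual_of_rfodc cA G := Subv (rhomP (pairing_rhom x)).
Definition to_lhom w : dual_of_rfovc cA Sinv X := Subv (lhomP (pairing_lhom w)).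

Lemma lin_to_rhom : linear to_rhom.
Proof.
move=> c u v; apply: val_inj; rewrite (lin_val (S := rHom G)).
by apply/boolp.funext => w; exact: (Bb.2 w).
Qed.

Lemma lin_to_lhom : linear to_lhom.
Proof.
move=> c u v; apply: val_inj; rewrite (lin_val (S := lHom X)).
by apply/boolp.funext => x; exact: (Bb.1 x).
Qed.

Lemma rhom_expand (f : subv (rHom G)) :
  f = to_rhom (\sum_(p <- s) lact (val f p.2) p.1).
Proof.
have /subspaceP [fl fr] := valP f.
apply: val_inj; apply/boolp.funext => w /=.
rewrite [in LHS](sG w) (lin_sumE _ _ fl) (lin_sumE _ _ (Bb.2 w)).
by apply: eq_bigr => p _; rewrite fr Bl.
Qed.

Lemma lhom_expand (f : subv (lHom X)) :
  f = to_lhom (\sum_(p <- s) ract p.2 (val f p.1)).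
Proof.
have /subspaceP [fl fr] := valP f.
apply: val_inj; apply/boolp.funext => x /=.
rewrite [in LHS](sX x) (lin_sumE _ _ fl) (lin_sumE _ _ (Bb.1 x)).
by apply: eq_bigr => p _; rewrite fr pairing_ract.
Qed.

Lemma to_rhom_bij : bijective to_rhom.
Proof.
exists (fun f => \sum_(p <- s) lact (val f p.2) p.1) => [x|f].
  by rewrite [RHS]sX.
by rewrite -rhom_expand.
Qed.

Lemma to_lhom_bij : bijective to_lhom.
Proof.
exists (fun f => \sum_(p <- s) ract p.2 (val f p.1)) => [w|f].
  by rewrite [RHS]sG.
by rewrite -lhom_expand.
Qed.

(** By [rhom_expand] an element of Hom ⊗ H is a combination of its values at the
    w_j, which is what makes the coaction of the dual well defined. *)
Lemma eval_rhom_inj :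
  injective (eval_tensor (fun f : subv (rHom G) => val f) (H := H)).
Proof.
have tl := lin_to_rhom.
have rec (t : tensor (subv (rHom G)) H) : t = \sum_(p <- s)
    \sw_(a, h <- eval_tensor (fun f : subv (rHom G) => val f) t p.2)
      (to_rhom (lact a p.1) : subv (rHom G)) ⊗ h.
  rewrite -[LHS]sw_id.
  transitivity (\sw_(f, h <- t) \sum_(p <- s)
      (to_rhom (lact (val f p.2) p.1) : subv (rHom G)) ⊗ h).
    apply: eq_sw => f h; rewrite {1}(rhom_expand f) (lin_sumE _ _ lin_to_rhom).
    by rewrite (lin_sumE _ _ ((bil_pure _ _).2 h)).
  rewrite sw_sum; apply: eq_bigr => p _.
  rewrite -[eval_tensor _ _ _]/(\sw_(f, h <- t) val f p.2 ⊗ h) sw_sw;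
    last by lin.
  by apply: eq_sw => f h; rewrite sw_pure //; lin.
by move=> t t' e; rewrite (rec t) (rec t') e.
Qed.

Lemma eval_lhom_inj :
  injective (eval_tensor (fun f : subv (lHom X) => val f) (H := H)).
Proof.
have tl := lin_to_lhom.
have rec (t : tensor (subv (lHom X)) H) : t = \sum_(p <- s)
    \sw_(a, h <- eval_tensor (fun f : subv (lHom X) => val f) t p.1)
      (to_lhom (ract p.2 a) : subv (lHom X)) ⊗ h.
  rewrite -[LHS]sw_id.
  transitivity (\sw_(f, h <- t) \sum_(p <- s)
      (to_lhom (ract p.2 (val f p.1)) : subv (lHom X)) ⊗ h).
    apply: eq_sw => f h; rewrite {1}(lhom_expand f) (lin_sumE _ _ lin_to_lhom).
    by rewrite (lin_sumE _ _ ((bil_pure _ _).2 h)).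
  rewrite sw_sum; apply: eq_bigr => p _.
  rewrite -[eval_tensor _ _ _]/(\sw_(f, h <- t) val f p.1 ⊗ h) sw_sw;
    last by lin.
  by apply: eq_sw => f h; rewrite sw_pure //; lin.
by move=> t t' e; rewrite (rec t) (rec t') e.
Qed.

(** The coaction of x |-> B (x, -) is the right one because
    B (x, w_0)_0 ⊗ B (x, w_0)_1 S(w_1) = B (x_0, w_0) ⊗ x_1 w_1 S(w_2). *)
Lemma fields_dual : rfovc_isomorphic cA X (dual_of_rfodc cA G).
Proof.
have tl := lin_to_rhom.
apply: (transport_rfovc (Φ := to_rhom)) => //.
- exact: to_rhom_bij.
- move=> a x; apply/esym/lift_alongE; first exact: val_inj.
  by apply/boolp.funext => w; exact: Bl.
- move=> x a; apply/esym/lift_alongE; first exact: val_inj.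
  by apply/boolp.funext => w; exact: Bmid.
- move=> x; apply: lift_alongE; first exact: eval_rhom_inj.
  apply/boolp.funext => w.
  rewrite -[RHS]/(\sw_(v, n <- δG w) \sw_(a, h <- δA (B x v)) a ⊗ (h * S n)).
  rewrite -[LHS]/(\sw_(f, h <- \sw_(p, q <- vf_rcoact x)
     (to_rhom p : subv (rHom G)) ⊗ q) val f w ⊗ h).
  rewrite sw_sw; last by lin.
  transitivity (\sw_(y, h <- δX x) \sw_(v, n <- δG w) \sw_(v', n' <- δG v)
      B y v' ⊗ (h * n' * S n)); last first.
    rewrite exchange_sw; apply: eq_sw => v n.
    rewrite pairing_coact sw_sw; last by lin.
    apply: eq_sw => y h; rewrite sw_sw; last by lin.
    by apply: eq_sw => v' n'; rewrite sw_pure //; lin.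
  apply: eq_sw => y h; rewrite sw_pure; last by lin.
  rewrite (rcoact_assoc (rcov_comodule (rfodc_rcov hG))); last by trilin.
  rewrite -[LHS](sw_rcounit (rcov_comodule (rfodc_rcov hG)) (fun v => B y v ⊗ h));
    last by lin.
  apply: eq_sw => v n; rewrite -[h in LHS]mulr1.
  rewrite -(sw_antipoder hH (fun c => B y v ⊗ (h * c))); last by lin.
  by apply: eq_sw => a b; rewrite mulrA.
Qed.

(** Likewise S^{-1}(x_2) x_1 cancels in the coaction of w |-> B (-, w). *)
Lemma forms_dual : rfodc_isomorphic cA G (dual_of_rfovc cA Sinv X).
Proof.
have tl := lin_to_lhom; have Sl := lin_Sinv SK SinvK.
apply: (transport_rfodc (Φ := to_lhom)) => //.
- exact: to_lhom_bij.
- move=> a w; apply/esym/lift_alongE; first exact: val_inj.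
  by apply/boolp.funext => x; rewrite /= Bmid.
- move=> w a; apply/esym/lift_alongE; first exact: val_inj.
  by apply/boolp.funext => x; exact: pairing_ract.
- move=> a; apply/esym/lift_alongE; first exact: val_inj.
  by apply/boolp.funext => x; exact: Bd.
- move=> w; apply: lift_alongE; first exact: eval_lhom_inj.
  apply/boolp.funext => x.
  rewrite -[RHS]/(\sw_(y, h <- δX x) \sw_(a, n <- δA (B y w)) a ⊗ (Sinv h * n)).
  rewrite -[LHS]/(\sw_(f, h <- \sw_(p, q <- form_rcoact w)
     (to_lhom p : subv (lHom X)) ⊗ q) val f x ⊗ h).
  rewrite sw_sw; last by lin.
  transitivity (\sw_(v, n <- δG w) \sw_(y, h <- δX x) \sw_(y', h' <- δX y)
      B y' v ⊗ (Sinv h * (h' * n))); last first.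
    rewrite exchange_sw; apply: eq_sw => y h.
    rewrite pairing_coact sw_sw; last by lin.
    rewrite exchange_sw; apply: eq_sw => y' h'.
    rewrite sw_sw; last by lin.
    by apply: eq_sw => v n; rewrite sw_pure //; lin.
  apply: eq_sw => v n; rewrite sw_pure; last by lin.
  rewrite (rcoact_assoc (rcov_comodule (rfovc_rcov hX))); last by trilin.
  rewrite -[LHS](sw_rcounit (rcov_comodule (rfovc_rcov hX)) (fun y => B y v ⊗ n));
    last by lin.
  apply: eq_sw => y h; rewrite -[n in LHS]mul1r.
  rewrite -(sw_Sinvl hH SK SinvK (fun c => B y v ⊗ (c * n))); last by lin.
  by apply: eq_sw => a b; rewrite mulrA.
Qed.

End Duality.

(** * The pairing of coinvariant forms with tangent vectors *)

Section LeftDual.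
Variables (k : fieldType) (A : algType k) (M : Bimodule A).
Local Notation N := (lHom_bimodule M).

Lemma lHomP (f : N) : is_lhom (val (f : subv (lHom M))).
Proof. by have /subspaceP := valP (f : subv (lHom M)). Qed.

Lemma val_lHom_lact a (f : N) x :
  bilinear_map (@ract k A M) ->
  (forall a m b, ract (lact a m) b = lact a (ract m b) :> M) ->
  val (lact a f : subv (lHom M)) x = val (f : subv (lHom M)) (ract x a).
Proof.
move=> br lr; have [fl fr] := lHomP f.
rewrite [X in X x = _]val_lift //; apply/subspaceP; split=> [|c m].
  exact: (lin_comp fl (br.2 a)).
by rewrite lr fr.
Qed.

Lemma val_lHom_ract (f : N) b x :
  val (ract f b : subv (lHom M)) x = val (f : subv (lHom M)) x * b.
Proof.
have [fl fr] := lHomP f.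
rewrite [X in X x = _]val_lift //; apply/subspaceP; split=> [|c m].
  exact: (lin_bil_l b (bil_mul A) fl).
by rewrite fr mulrA.
Qed.

End LeftDual.

Section CoinvariantPairing.
Variables (k : fieldType) (H : algType k) (hH : hopf H) (Sinv : H -> H).
Hypothesis SinvK : cancel Sinv (antipode hH).
Variables (g : submodClosed (H -> k^o)) (hg : is_quantum_tangent_space hH g).
Variables (Gamma : BiFODC H) (hGamma : is_bifodc hH Gamma).
Variable Phi : Gamma -> dual_of_bifovc hH Sinv (tangent_bifovc hH g).
Hypothesis hPhi : is_bifodc_iso Phi.
Local Notation Δ := (comul hH).
Local Notation S := (antipode hH).
Local Notation ε := (counit hH).
Local Notation X := (vertical_fields g (self_comodule_algebra hH)).
Local Notation Λ := (subv (left_coinvariants hGamma)).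
Local Notation ϖ := (maurer_cartan hGamma).

Let isoB := rfodc_iso_bimodule (bifodc_iso_r hPhi).
Let Phil : linear Phi := bimodule_iso_linear isoB.

(** The pairing of the calculus Gamma with H ⊗ g that the isomorphism Phi gives. *)
Definition eval_form (w : Gamma) (x : X) : H := val (Phi w) x.

Lemma bil_eval_form : bilinear_map eval_form.
Proof.
split=> [w|x]; first by have /subspaceP [] := valP (Phi w).
by apply: (lin_comp (lin_valapp (S := lHom X) x) Phil).
Qed.

Lemma eval_form_field_lact w a x : eval_form w (lact a x) = a * eval_form w x.
Proof. have /subspaceP [_ h] := valP (Phi w); exact: h. Qed.

Lemma eval_form_lact a w x : eval_form (lact a w) x = eval_form w (ract x a).
Proof.
have hb := rcov_bimodule (rfodc_rcov (bifodc_rfodc hGamma)).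
rewrite /eval_form -[lact a w](ract1 hb) (bimodule_iso_act isoB).
rewrite [LHS]val_lHom_ract mulr1 [LHS]val_lHom_lact //.
  exact: bil_vfield_ract.
by move=> *; rewrite vfield_lract.
Qed.

Lemma eval_form_diff a x : eval_form (diff Gamma a) x = lie x a.
Proof.
rewrite /eval_form (rfodc_iso_diff (bifodc_iso_r hPhi)).
rewrite [X in X x = _]val_lift //; apply/subspaceP; split=> [|c m].
  exact: ((bil_vfield_lie hg _).2 a).
exact: vfield_lie_lact.
Qed.

Lemma eval_form_inj w : (forall χ, eval_form w (1 ⊗ χ) = 0) -> w = 0.
Proof.
move=> h; apply: (bij_inj (bimodule_iso_bij isoB)).
rewrite (linear_at0 Phil); apply: val_inj; apply/boolp.funext => x.
have e : forall x, eval_form w x = (fun=> 0) x.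
  apply: vfield_ext; [exact: bil_eval_form.1 | exact: lin0 |].
  move=> a χ; rewrite -[a]mulr1 -vfield_lact_pure.
  by rewrite eval_form_field_lact h mulr0.
exact: e.
Qed.

(** ϖ(h) = S(h_1) dh_2 pairs with 1 ⊗ χ to
    L_{(1 ⊗ χ) S(h_1)}(h_2) = L_χ(S(h_1) h_2) - L_χ(S(h_1)) h_2. The first term
    vanishes as χ(1) = 0, and the second is S(h_2) χ(S(h_1)) h_3 = χ(S(h)) 1. *)
Lemma eval_form_maurer_cartan h χ :
  eval_form (val (ϖ h)) (1 ⊗ χ) = (- val χ (S h) : k) *: 1.
Proof.
have bL := bil_vfield_lie hg (self_comodule_algebra hH).
rewrite maurer_cartanE /= /to_coinv.
rewrite (diff_lcolinear hGamma) -[X in sw X]/(\sw_(x, y <- Δ h) x ⊗ diff Gamma y).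
have blG := lact_bilinear (rcov_bimodule (rfodc_rcov (bifodc_rfodc hGamma))).
rewrite sw_sw; last by lin.
rewrite (lin_swE (fun w => eval_form w (1 ⊗ χ))); last exact: bil_eval_form.2.
transitivity (\sw_(x, y <- Δ h) (lie (1 ⊗ χ : X) (S x * y) - lie (1 ⊗ χ : X) (S x) * y)).
  apply: eq_sw => x y; rewrite sw_pure; last by lin.
  by rewrite eval_form_lact eval_form_diff vfield_leibniz // addrC addKr.
transitivity (\sw_(x, y <- Δ h) lie (1 ⊗ χ : X) (S x * y)
              + \sw_(x, y <- Δ h) - (lie (1 ⊗ χ : X) (S x) * y)).
  by rewrite sw_add.
rewrite (sw_antipodel hH (fun v => lie (1 ⊗ χ : X) v)); last exact: bL.1.
rewrite (vfield_lie1 hg) scaler0 add0r -(lin_swE (fun v => - v)); last by lin.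
rewrite scaleNr; congr (- _).
transitivity (\sw_(x, y <- Δ h) \sw_(a, b <- Δ x) (val χ (S a) : k) *: (S b * y)).
  apply: eq_sw => x y; rewrite vfield_lie_pure //.
  rewrite -[coact _ _]/(Δ (S x)) antipode_comul; last by lin.
  rewrite (lin_swE (fun v => v * y)); last by lin.
  by apply: eq_sw => a b; rewrite mul1r scalerAl.
rewrite comul_assoc; last by trilin.
rewrite -[RHS](comul_counitr hH (fun v => (val χ (S v) : k) *: 1)); last by lin.
apply: eq_sw => a z.
by rewrite (sw_antipodel hH (fun v => (val χ (S a) : k) *: v)) //; lin.
Qed.

(** A Maurer-Cartan form takes scalar values on 1 ⊗ g, so the counit reads off
    the scalar; see [coinv_pairingE]. *)
Definition coinv_pairing (θ : Λ) (χ : subv g) : k^o := ε (eval_form (val θ) (1 ⊗ χ)).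

Lemma bil_coinv_pairing : bilinear_map coinv_pairing.
Proof.
have eb := bil_eval_form.
split=> [θ|χ].
  exact: (lin_counit_comp hH (lin_comp (eb.1 _) ((bil_pure _ _).1 1))).
exact: (lin_counit_comp hH (lin_comp (eb.2 _) (lin_val (S := left_coinvariants hGamma)))).
Qed.

Lemma coinv_pairing_maurer_cartan h χ : coinv_pairing (ϖ h) χ = - val χ (S h).
Proof.
rewrite /coinv_pairing eval_form_maurer_cartan (linZ _ _ (lin_counit hH)) counit1.
exact: mulr1.
Qed.

Lemma coinv_pairingE θ χ : eval_form (val θ) (1 ⊗ χ) = (coinv_pairing θ χ : k) *: 1.
Proof.
have [h ->] := maurer_cartan_surj θ.
by rewrite coinv_pairing_maurer_cartan eval_form_maurer_cartan.
Qed.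

Lemma coinv_pairing_inj θ : (forall χ, coinv_pairing θ χ = 0) -> θ = 0.
Proof.
move=> h; apply: val_inj; rewrite (linear_at0 (lin_val (S := left_coinvariants hGamma))).
by apply: eval_form_inj => χ; rewrite coinv_pairingE h scale0r.
Qed.

(** A dual basis (χ_i, h_i) of g turns into pairs (χ_i, ϖ(- S^{-1}(h_i))), since
    b(ϖ(h), χ) = - χ(S(h)). The expansion in Λ follows by nondegeneracy. *)
Lemma coinv_dual_basis : exists s : seq (subv g * Λ),
  (forall χ, χ = \sum_(p <- s) (coinv_pairing p.2 χ : k) *: p.1) /\
  (forall θ, θ = \sum_(p <- s) (coinv_pairing θ p.1 : k) *: p.2).
Proof.
have bb := bil_coinv_pairing.
have [s hs] := tangent_dual_basis hg.
pose s' := [seq (p.1, ϖ (- Sinv p.2)) | p <- s].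
have hs' χ : χ = \sum_(p <- s') (coinv_pairing p.2 χ : k) *: p.1.
  rewrite big_map /= [LHS]hs; apply: eq_bigr => p _.
  rewrite coinv_pairing_maurer_cartan.
  have l : linear (fun h => val χ h) by lin.
  have lS := antipode_linear hH.
  by rewrite (linN _ lS) SinvK (linN _ l) opprK.
exists s'; split=> // θ; apply/eqP; rewrite -subr_eq0; apply/eqP.
apply: coinv_pairing_inj => χ.
rewrite (linB _ _ (bb.2 χ)) (lin_sumE _ _ (bb.2 χ)).
rewrite [in X in X - _](hs' χ) (lin_sumE _ _ (bb.1 θ)) -sumrB big1 // => p _.
by rewrite (linZ _ _ (bb.1 θ)) (linZ _ _ (bb.2 χ)) /GRing.scale /= mulrC subrr.
Qed.

Lemma coinv_pairing_perfect : perfect_pairing coinv_pairing.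
Proof.
have bb := bil_coinv_pairing.
have [s [hs1 hs2]] := coinv_dual_basis.
split=> // f fl.
- exists (\sum_(p <- s) (f p.1 : k) *: p.2); split.
    apply/boolp.funext => χ; rewrite (lin_sumE _ _ (bb.2 χ)).
    rewrite [in RHS](hs1 χ) (lin_sumE _ _ fl); apply: eq_bigr => p _.
    by rewrite (linZ _ _ (bb.2 χ)) (linZ _ _ fl) /GRing.scale /= mulrC.
  by move=> θ hθ; rewrite [RHS]hs2 hθ.
- exists (\sum_(p <- s) (f p.2 : k) *: p.1); split.
    apply/boolp.funext => θ; rewrite (lin_sumE _ _ (bb.1 θ)).
    rewrite [in RHS](hs2 θ) (lin_sumE _ _ fl); apply: eq_bigr => p _.
    by rewrite (linZ _ _ (bb.1 θ)) (linZ _ _ fl) /GRing.scale /= mulrC.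
  move=> χ hχ; rewrite [RHS]hs1; apply: eq_bigr => p _.
  by rewrite -hχ.
Qed.

End CoinvariantPairing.

(** * The pairing of vertical fields with vertical forms *)

Section VerticalPairing.
Variables (k : fieldType) (H : algType k) (hH : hopf H) (Sinv : H -> H).
Hypotheses (SK : cancel (antipode hH) Sinv) (SinvK : cancel Sinv (antipode hH)).
Variables (A : algType k) (cA : comodule_algebra hH A) (galA : hopf_galois cA).
Variables (g : submodClosed (H -> k^o)).
Hypotheses (hg : is_quantum_tangent_space hH g) (bg : bicovariant_qts hH g).
Variables (Gamma : BiFODC H) (hGamma : is_bifodc hH Gamma).
Local Notation Δ := (comul hH).
Local Notation S := (antipode hH).
Local Notation ε := (counit hH).
Local Notation δA := (coact cA).
Local Notation X := (vertical_fields g cA).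
Local Notation Y := (vertical_forms cA hGamma).
Local Notation Λ := (subv (left_coinvariants hGamma)).
Local Notation ϖ := (maurer_cartan hGamma).
Variable b : Λ -> subv g -> k^o.
Hypothesis bb : bilinear_map b.
Hypothesis bϖ : forall h χ, b (ϖ h) χ = - val χ (S h).
Variable s : seq (subv g * Λ).
Hypothesis sg : forall χ, χ = \sum_(p <- s) (b p.2 χ : k) *: p.1.
Hypothesis sΛ : forall θ, θ = \sum_(p <- s) (b θ p.1 : k) *: p.2.

Let hX : is_rfovc cA X := vertical_fields_rfovc hg bg (galois_translation SinvK galA).
Let hY : is_rfodc cA Y := vertical_forms_rfodc hGamma galA.
Let hbX := rcov_bimodule (rfovc_rcov hX).
Let blX : bilinear_map (@lact k A X) := lact_bilinear hbX.
Let brX : bilinear_map (@ract k A X) := ract_bilinear hbX.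
Let blY : bilinear_map (@lact k A Y) := bil_vform_lact cA hGamma.
Let brY : bilinear_map (@ract k A Y) := bil_vform_ract cA hGamma.

Definition contract (θ : Λ) (x : X) : A :=
  \sw_(a, χ <- (x : tensor A (subv g))) (b θ χ : k) *: a.

Definition vertical_pairing (x : X) (w : Y) : A :=
  \sw_(a, θ <- (w : tensor A Λ)) contract θ (ract x a).

Local Notation B := vertical_pairing.

Lemma bil_contract : bilinear_map contract.
Proof.
suff l : bilinear_map (fun θ (x : tensor A (subv g)) =>
  \sw_(a, χ <- x) (b θ χ : k) *: a) by exact: l.
by split=> [θ|x]; [apply: lin_sw; split=> [a|χ] | apply: lin_sw_body => a χ];
  [apply: (@lin_scalel _ _ _ (b θ)); exact: bb.1 | lin
  | apply: (@lin_scalel _ _ _ (b^~ χ)); exact: bb.2].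
Qed.

Lemma bil_vertical_pairing : bilinear_map B.
Proof.
have bc := bil_contract.
suff l : bilinear_map (fun (x : X) (w : tensor A Λ) =>
  \sw_(a, θ <- w) contract θ (ract x a)) by exact: l.
by lin.
Qed.

Lemma contract_pure θ a χ : contract θ (a ⊗ χ : X) = (b θ χ : k) *: a.
Proof.
rewrite /contract sw_pure //; split=> [c|χ']; last by lin.
by apply: (@lin_scalel _ _ _ (b θ)); exact: bb.1.
Qed.

Lemma contract_lact θ a x : contract θ (lact a x) = a * contract θ x.
Proof.
have bc := bil_contract.
move: x; apply: vfield_ext; try by lin.
by move=> c χ; rewrite vfield_lact_pure // !contract_pure scalerAr.
Qed.

Lemma pairing_pure x a θ : B x (a ⊗ θ : Y) = contract θ (ract x a).
Proof. by have bc := bil_contract; rewrite /B sw_pure //; lin. Qed.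

Lemma pairing_mid x a w : B (ract x a) w = B x (lact a w).
Proof.
have bB := bil_vertical_pairing.
move: w; apply: vform_ext; try by lin.
by move=> c θ; rewrite vform_lact_pure !pairing_pure (ractM hbX).
Qed.

Lemma pairing_lact a x w : B (lact a x) w = a * B x w.
Proof.
have bB := bil_vertical_pairing.
move: w; apply: vform_ext; try by lin.
by move=> c θ; rewrite !pairing_pure (lract hbX) contract_lact.
Qed.

(** On x = e ⊗ χ the pairing is the sum of - e a_0 f^j(a_1) χ_j(S(a_2)), which is
    e a_0 (χ(a_1) ε(a_2) - χ(a_1 S(a_2))), and the last term vanishes. *)
Lemma pairing_diff x a : B x (diff Y a) = lie x a.
Proof.
have bB := bil_vertical_pairing; have bc := bil_contract.
have bL := bil_vfield_lie hg cA.
move: x; apply: vfield_ext; try by lin.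
move=> e χ; rewrite vform_diffE (lin_swE (B (e ⊗ χ))); last by lin.
transitivity (\sw_(c, h <- δA a) \sw_(c0, n <- δA c)
    (ε h *: ((val χ n : k) *: (e * c0)) - (val χ (n * S h) : k) *: (e * c0))).
  apply: eq_sw => c h; rewrite pairing_pure vfield_ract_pure //.
  rewrite (lin_swE (contract (ϖ h))); last by lin.
  apply: eq_sw => c0 n; rewrite (lin_swE (contract (ϖ h))); last by lin.
  rewrite scalerA mulrC -scalerBl -opprB -{1}(counit_antipode hH h) -coeffP // scaleNr.
  rewrite (lin_swE (fun z : k^o => (z : k) *: (e * c0))); last first.
    by apply: (@lin_scalel _ _ _ (fun z : k^o => z)).
  rewrite (lin_swE (fun v => - v)); last by lin.
  apply: eq_sw => f χ'.
  by rewrite contract_pure bϖ scaleNr scalerA mulrC.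
rewrite (rcoact_assoc (coact_rcomodule cA)); last by trilin.
rewrite vfield_lie_pure //; apply: eq_sw => c0 z.
transitivity (\sw_(n, h <- Δ z) ε h *: ((val χ n : k) *: (e * c0)) +
  \sw_(n, h <- Δ z) - ((val χ (n * S h) : k) *: (e * c0))); first by rewrite sw_add.
rewrite (comul_counitr hH (fun n => (val χ n : k) *: (e * c0))); last by lin.
rewrite -(lin_swE (fun v => - v)); last by lin.
rewrite (sw_antipoder hH (fun n => (val χ n : k) *: (e * c0))); last by lin.
by rewrite (tangent1 hg) scale0r scaler0 subr0.
Qed.

Lemma vertical_field_expand (x : X) :
  x = \sum_(p <- [seq (1 ⊗ p.1 : X, 1 ⊗ p.2 : Y) | p <- s]) lact (B x p.2) p.1.
Proof.
have bB := bil_vertical_pairing.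
rewrite big_map; cbn [fst snd].
move: x; apply: (vfield_ext (f := fun x => x)); try by lin.
move=> a χ; rewrite {1}[χ]sg (lin_sumE _ _ ((bil_pure _ _).1 a)).
apply: eq_bigr => p _.
rewrite pairing_pure (ract1 hbX) contract_pure vfield_lact_pure // mulr1.
by rewrite (linZ _ _ ((bil_pure _ _).1 a)) (linZ _ _ ((bil_pure _ _).2 p.1)).
Qed.

(** The coinvariant forms generate the vertical forms from the right, thanks to
    S^{-1}(a_2) a_1 = ε(a). *)
Lemma coinv_generate a θ : (a ⊗ θ : Y) =
  \sw_(c, h <- δA a) ract (1 ⊗ coinv_ract θ (Sinv h) : Y) c.
Proof.
have br' := bil_coinv_ract hGamma; have Sl := lin_Sinv SK SinvK.
transitivity (\sw_(c, h <- δA a) \sw_(c0, n <- δA c)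
    (c0 ⊗ coinv_ract θ (Sinv h * n) : Y)); last first.
  apply: eq_sw => c h; rewrite vform_ract_pure; apply: eq_sw => c0 n.
  by rewrite mul1r coinv_ractM.
rewrite (rcoact_assoc (coact_rcomodule cA)); last by trilin.
rewrite -[LHS](sw_rcounit (coact_rcomodule cA) (fun c => c ⊗ θ : Y));
  last by lin.
apply: eq_sw => c z; rewrite -[θ in LHS]coinv_ract1.
by rewrite -(sw_Sinvl hH SK SinvK (fun v => c ⊗ coinv_ract θ v : Y)) //; lin.
Qed.

(** The pairing is right linear in w, so it suffices to expand the generators
    (1 ⊗ θ) c. *)
Lemma vertical_form_expand (w : Y) :
  w = \sum_(p <- [seq (1 ⊗ p.1 : X, 1 ⊗ p.2 : Y) | p <- s]) ract p.2 (B p.1 w).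
Proof.
have bB := bil_vertical_pairing.
rewrite big_map; cbn [fst snd].
have gen c θ : ract (1 ⊗ θ : Y) c =
    \sum_(p <- s) ract (1 ⊗ p.2 : Y) (B (1 ⊗ p.1 : X) (ract (1 ⊗ θ : Y) c)).
  rewrite {1}[θ]sΛ (lin_sumE _ _ ((bil_pure _ _).1 1)) (lin_sumE _ _ (brY.2 c)).
  apply: eq_bigr => p _.
  rewrite (pairing_ract hX hY bB pairing_mid pairing_diff).
  rewrite pairing_pure (ract1 hbX) contract_pure -scalerAl mul1r.
  by rewrite (linZ _ _ ((bil_pure _ _).1 1)) (linZ _ _ (brY.2 c)) (linZ _ _ (brY.1 _)).
move: w; apply: (vform_ext (f := fun w => w)); try by lin.
move=> a θ; rewrite coinv_generate.
rewrite (lin_swE (fun w : Y => \sum_(p <- s) ract (1 ⊗ p.2 : Y) (B (1 ⊗ p.1 : X) w)));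
  last by lin.
by apply: eq_sw => c h; rewrite -gen.
Qed.

Lemma vertical_duality :
  rfovc_isomorphic cA X (dual_of_rfodc cA Y) /\
  rfodc_isomorphic cA Y (dual_of_rfovc cA Sinv X).
Proof.
have bB := bil_vertical_pairing.
split.
- exact: (fields_dual hX hY bB pairing_mid pairing_lact pairing_diff
    vertical_field_expand vertical_form_expand).
- exact: (forms_dual SK SinvK hX hY bB pairing_mid pairing_lact pairing_diff
    vertical_field_expand vertical_form_expand).
Qed.

End VerticalPairing.

Theorem proposition3p20 (k : fieldType)
    (H : algType k) (hH : hopf H) (Sinv : H -> H)
    (SK : cancel (antipode hH) Sinv) (SinvK : cancel Sinv (antipode hH))
    (A : algType k) (cA : comodule_algebra hH A) (galA : hopf_galois cA)
    (g : submodClosed (H -> k^o)) (hg : is_quantum_tangent_space hH g)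
    (bg : bicovariant_qts hH g)
    (Gamma : BiFODC H) (hGamma : is_bifodc hH Gamma)
    (Phi : Gamma -> dual_of_bifovc hH Sinv (tangent_bifovc hH g))
    (hPhi : is_bifodc_iso Phi) :
  (exists b : subv (left_coinvariants hGamma) -> subv g -> k^o,
     perfect_pairing b /\
     forall w chi, val (Phi (val w)) (1 ⊗ chi) = (b w chi : k) *: 1) /\
  rfovc_isomorphic cA (vertical_fields g cA)
    (dual_of_rfodc cA (vertical_forms cA hGamma)) /\
  rfodc_isomorphic cA (vertical_forms cA hGamma)
    (dual_of_rfovc cA Sinv (vertical_fields g cA)).
Proof.
have [s [sg sL]] := coinv_dual_basis SinvK hg hGamma hPhi.
split.
  exists (coinv_pairing (hGamma := hGamma) Phi); split.
    exact: coinv_pairing_perfect.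
  exact: coinv_pairingE.
exact: (vertical_duality SK SinvK galA hg bg
  (bil_coinv_pairing hGamma hPhi)
  (coinv_pairing_maurer_cartan hg hGamma hPhi) sg sL).
Qed.
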